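(* Let $0<\epsilon<n-1$ be fixed and let $$f(x)=\epsilon|x|^{-1-\epsilon}\sin(|x|^{-\epsilon})+(n-1)|x|^{-1}\cos(|x|^{-\epsilon}),\qquad x\in\mathbb{R}^n.$$ Then $$f(x)=\operatorname{div}\left[x|x|^{-1}\cos(|x|^{-\epsilon})\right].$$ Moreover, there exists a sequence $\{r_k\}$ decreasing to zero such that $$\int_{B_{r_k}(0)}f^+(x)\,dx\ge c\,r_k^{\,n-1-\epsilon}$$ for a constant $c=c(n,\epsilon)>0$ independent of $k$, where $f^+$ is the positive part of $f$. Thus $f$ belongs to $BV(\mathbb{R}^n)^*$, whereas $|f|$ does not.
   Context: $BV(\mathbb{R}^n)$ is the space of all $u\in L^1(\mathbb{R}^n)$ whose distributional gradient $Du$ is a finite vector-valued measure, with norm $\|Du\|(\mathbb{R}^n)$ (total variation). $BV_c^\infty(\mathbb{R}^n)$ is the (dense) subspace of bounded functions with compact support. A locally integrable function $g$ is identified with the locally finite signed measure $g\,dx$, and ''$g\in BV(\mathbb{R}^n)^*$'' means that the functional $u\mapsto\int_{\mathbb{R}^n}u\,g\,dx$, $u\in BV_c^\infty(\mathbb{R}^n)$, is continuous in the norm $\|Du\|(\mathbb{R}^n)$, hence extends uniquely to a continuous linear functional on $BV(\mathbb{R}^n)$; i.e. there is a constant $C$ with $\left|\int u\,g\,dx\right|\le C\|Du\|(\mathbb{R}^n)$ for all $u\in BV_c^\infty(\mathbb{R}^n)$. The divergence identity holds in the sense of distributions on $\mathbb{R}^n$. $B_r(0)$ is the ball of radius $r$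 centered at $0$. *)

(* Defs.v *)
From HB Require Import structures.
From mathcomp Require Import all_boot all_order all_algebra.
From mathcomp Require Import all_classical all_reals all_analysis.

Set Implicit Arguments.
Unset Strict Implicit.
Unset Printing Implicit Defensive.

Import Order.TTheory GRing.Theory Num.Theory.
Import numFieldNormedType.Exports.

Local Open Scope classical_set_scope.
Local Open Scope ring_scope.

(* Row vectors carry the product sigma-algebra, generated by the coordinate
   maps, exactly as the library does for [n.-tuple T]. *)
Definition measure_rV_display : measure_display -> measure_display.
Proof. exact. Qed.

Section measurable_rV.
Context {d} {T : sigmaRingType d}.
Variable n : nat.

Let coors : 'I_n -> 'rV[T]_n -> T := fun i x => x ord0 i.

Let rV_set0 : g_sigma_preimage coors set0.
Proof. exact: sigma_algebra0. Qed.

Let rV_setC A : g_sigma_preimage coors A -> g_sigma_preimage coors (~` A).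
Proof. exact: sigma_algebraC. Qed.

Let rV_bigcup (F : _^nat) : (forall i, g_sigma_preimage coors (F i)) ->
  g_sigma_preimage coors (\bigcup_i (F i)).
Proof. exact: sigma_algebra_bigcup. Qed.

HB.instance Definition _ := @isMeasurable.Build (measure_rV_display d)
  'rV[T]_n (g_sigma_preimage coors) rV_set0 rV_setC rV_bigcup.

End measurable_rV.

Section measurable_rV_theory.
Context {d} {T : measurableType d}.

Lemma measurable_coord n (i : 'I_n) :
  measurable_fun [set: 'rV[T]_n] (fun x => x ord0 i).
Proof.
move=> _ Y mY; rewrite setTI; apply: sub_sigma_algebra.
by rewrite (bigD1 i)//=; left; exists Y => //; rewrite setTI.
Qed.

Lemma measurable_fun_rVP d1 (T1 : measurableType d1) n (f : T1 -> 'rV[T]_n) :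
  (forall i, measurable_fun setT (fun t => f t ord0 i)) ->
  measurable_fun setT f.
Proof.
move=> mf; apply: (measurability
  (\big[setU/set0]_(i < n) preimage_set_system setT
     (fun x : 'rV[T]_n => x ord0 i) measurable)) => //.
move=> _ [A + <-].
elim/big_rec : _ => [//|i X _ hX [[B mB <-]|/hX//]].
by have := mf i measurableT B mB; rewrite !setTI.
Qed.

End measurable_rV_theory.

Section lebesgue_rV.
Variable R : realType.

Definition cons_rV n (p : measurableTypeR R * 'rV[R]_n) : 'rV[R]_n.+1 :=
  row_mx (const_mx p.1 : 'rV[R]_1) p.2.

(* Lebesgue measure on R^n: the n-fold product of one-dimensional Lebesgue
   measure, transported along R * R^n ~ R^(n+1). *)
Fixpoint lebesgue_rV n : set 'rV[R]_n -> \bar R :=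
  match n with
  | 0%N => \d_(0 : 'rV[R]_0)
  | n'.+1 => pushforward
      (product_measure1 (@lebesgue_measure R) (@lebesgue_rV n')) (@cons_rV n')
  end.

Lemma cons_rV0 n (p : measurableTypeR R * 'rV[R]_n) : cons_rV p ord0 ord0 = p.1.
Proof.
have -> : (ord0 : 'I_n.+1) = lshift n (ord0 : 'I_1) by exact: val_inj.
by rewrite (@row_mxEl _ _ 1) mxE.
Qed.

Lemma cons_rVS n (p : measurableTypeR R * 'rV[R]_n) (i : 'I_n) :
  cons_rV p ord0 (lift ord0 i) = p.2 ord0 i.
Proof.
have -> : lift ord0 i = rshift 1 i by exact: val_inj.
by rewrite (@row_mxEr _ _ 1).
Qed.

Lemma measurable_cons_rV n : measurable_fun setT (@cons_rV n).
Proof.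
apply: measurable_fun_rVP => i; case: (unliftP ord0 i) => [j|] ->.
  apply: (eq_measurable_fun (fun p : measurableTypeR R * 'rV[R]_n => p.2 ord0 j)).
    by move=> p _; rewrite cons_rVS.
  exact: (measurableT_comp (measurable_coord j) measurable_snd).
apply: (eq_measurable_fun (fun p : measurableTypeR R * 'rV[R]_n => p.1)).
  by move=> p _; rewrite cons_rV0.
exact: measurable_fst.
Qed.


Section cons_measure.
Variables (n : nat) (m : {sigma_finite_measure set 'rV[R]_n -> \bar R}).

Let prodm : {measure set (measurableTypeR R * 'rV[R]_n) -> \bar R} :=
  (lebesgue_measure \x m)%E.

Definition cons_measure : set 'rV[R]_n.+1 -> \bar R :=
  pushforward prodm (@cons_rV n).

Let mcons A : measurable A -> measurable (@cons_rV n @^-1` A).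
Proof. by move=> mA; rewrite -[X in measurable X]setTI; exact: measurable_cons_rV. Qed.

Let cons_measure0 : cons_measure set0 = 0%E.
Proof. by rewrite /cons_measure /pushforward preimage_set0 measure0. Qed.

Let cons_measure_ge0 A : (0 <= cons_measure A)%E.
Proof. exact: (measure_ge0 prodm). Qed.

Let cons_measure_semi_sigma_additive : semi_sigma_additive cons_measure.
Proof.
move=> F mF tF mUF; rewrite /cons_measure /pushforward preimage_bigcup.
apply: measure_semi_sigma_additive.
- by move=> k; exact: mcons.
- apply/trivIsetP => /= i j _ _ ij; rewrite -preimage_setI.
  by move/trivIsetP : tF => /(_ _ _ _ _ ij) ->//; rewrite preimage_set0.
- by rewrite -preimage_bigcup; exact: mcons.
Qed.

HB.instance Definition _ := isMeasure.Build _ _ _ cons_measure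
  cons_measure0 cons_measure_ge0 cons_measure_semi_sigma_additive.

Lemma cons_measureE (A : set R) (B : set 'rV[R]_n) :
  measurable A -> measurable B ->
  cons_measure [set x : 'rV[R]_n.+1 | A (x ord0 ord0) /\ B (\row_j x ord0 (lift ord0 j))] =
  (lebesgue_measure A * m B)%E.
Proof.
move=> mA mB; rewrite -product_measure1E//; congr (product_measure1 _ _ _).
apply/seteqP; split=> -[a b] /=; rewrite cons_rV0;
  by have -> : \row_j cons_rV (a, b) ord0 (lift ord0 j) = b
    by apply/rowP => j; rewrite mxE cons_rVS.
Qed.

Let cons_measure_sigma_finite : sigma_finite setT cons_measure.
Proof.
have /sigma_finiteP[F [FT ndF Foo]] := sigma_finiteT (@lebesgue_measure R).
have /sigma_finiteP[G [GT ndG Goo]] := sigma_finiteT m.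
exists (fun k => [set x : 'rV[R]_n.+1 | F k (x ord0 ord0) /\
                          G k (\row_j x ord0 (lift ord0 j))]).
  apply/esym; rewrite -subTset => x _.
  have : setT (x ord0 ord0) by [].
  rewrite FT => -[k _ Fk].
  have : [set: 'rV[R]_n] (\row_j x ord0 (lift ord0 j)) by [].
  rewrite GT => -[l _ Gl]; exists (maxn k l) => //; split.
    by move: Fk; apply/subsetPset/ndF/leq_maxl.
  by move: Gl; apply/subsetPset/ndG/leq_maxr.
move=> k; have [mF Fk] := Foo k; have [mG Gk] := Goo k; split.
  apply: measurableI; rewrite -[X in measurable X]setTI.
    exact: measurable_coord.
  apply: (measurable_fun_rVP (f := fun x : 'rV[R]_n.+1 =>
    \row_j x ord0 (lift ord0 j))) => // i.
  under eq_fun do rewrite mxE.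
  exact: measurable_coord.
by rewrite cons_measureE// lte_mul_pinfty// ge0_fin_numE.
Qed.

HB.instance Definition _ := Measure_isSigmaFinite.Build _ _ _ cons_measure
  cons_measure_sigma_finite.

End cons_measure.

Lemma lebesgue_rV_sigma_finite_measure n :
  exists m : {sigma_finite_measure set 'rV[R]_n -> \bar R},
    m = @lebesgue_rV n :> (set _ -> _).
Proof.
elim: n => [|n [m mE]]; first by exists \d_(0 : 'rV[R]_0).
by exists (cons_measure m); rewrite /= -mE.
Qed.

Section lebesgue_rV_measure.
Variable n : nat.

Let lebesgue_rV0 : @lebesgue_rV n set0 = 0%E.
Proof.
by have [m <-] := lebesgue_rV_sigma_finite_measure n; exact: measure0.
Qed.

Let lebesgue_rV_ge0 (A : set 'rV[R]_n) : (0 <= @lebesgue_rV n A)%E.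
Proof.
by have [m <-] := lebesgue_rV_sigma_finite_measure n; exact: measure_ge0.
Qed.

Let lebesgue_rV_semi_sigma_additive : semi_sigma_additive (@lebesgue_rV n).
Proof.
have [m <-] := lebesgue_rV_sigma_finite_measure n.
exact: measure_semi_sigma_additive.
Qed.

HB.instance Definition _ := isMeasure.Build _ _ _ (@lebesgue_rV n)
  lebesgue_rV0 lebesgue_rV_ge0 lebesgue_rV_semi_sigma_additive.

Let lebesgue_rV_sigma_finite : sigma_finite setT (@lebesgue_rV n).
Proof.
by have [m <-] := lebesgue_rV_sigma_finite_measure n; exact: sigma_finiteT.
Qed.

HB.instance Definition _ := Measure_isSigmaFinite.Build _ _ _ (@lebesgue_rV n)
  lebesgue_rV_sigma_finite.

End lebesgue_rV_measure.

Lemma measurable_box n (A : 'I_n -> set R) : (forall i, measurable (A i)) ->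
  measurable [set x : 'rV[R]_n | forall i, A i (x ord0 i)].
Proof.
move=> mA.
rewrite (_ : mkset _ = \big[setI/setT]_(i < n) [set x : 'rV[R]_n | A i (x ord0 i)]).
  apply: bigsetI_measurable => i _; rewrite -[X in measurable X]setTI.
  exact: measurable_coord.
apply/seteqP; split=> x.
  by move=> Ax; elim/big_rec : _ => // i X _ hX; split=> //; exact: Ax.
by move=> + i /=; rewrite (bigD1 i)//= => -[].
Qed.

Lemma lebesgue_rV_box n (A : 'I_n -> set R) : (forall i, measurable (A i)) ->
  lebesgue_rV [set x : 'rV[R]_n | forall i, A i (x ord0 i)] =
  (\prod_(i < n) lebesgue_measure (A i))%E.
Proof.
elim: n A => [|n ih] A mA.
  by rewrite big_ord0 /= diracE mem_set// => -[].
have [m mE] := lebesgue_rV_sigma_finite_measure n.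
rewrite big_ord_recl -ih// -mE -cons_measureE//; last first.
  exact: (measurable_box (A := fun i => A (lift ord0 i))).
rewrite /= -mE; congr (product_measure1 _ _ (_ @^-1` _)).
apply/seteqP; split=> x /=.
  by move=> Ax; split=> // i; rewrite mxE.
move=> [A0 AS] i; case: (unliftP ord0 i) => [j|] -> //.
by have := AS j; rewrite mxE.
Qed.

End lebesgue_rV.

Section calculus.
Context {R : realType} {n : nat}.
Implicit Types (x : 'rV[R]_n) (g phi : 'rV[R]_n -> R).

(* The norm [`|x|] of the library on 'rV[R]_n is the sup norm. *)
Definition enorm x : R := Num.sqrt (\sum_(i < n) x ord0 i ^+ 2).

Definition eball (r : R) : set 'rV[R]_n := [set x | enorm x < r].

Definition partial (i : 'I_n) g : 'rV[R]_n -> R :=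
  fun x => 'D_(delta_mx ord0 i) g x.

(* All iterated partial derivatives exist and are continuous. *)
Definition smooth g := forall s : seq 'I_n,
  let h := foldr partial g s in
  continuous h /\ forall i x, derivable h x (delta_mx ord0 i).

Definition test_function phi :=
  smooth phi /\ compact (closure [set x | phi x != 0]).

Local Notation mu := (@lebesgue_rV R n).

Definition locally_integrable_rV g := measurable_fun setT g /\
  forall K : set 'rV[R]_n, compact K -> mu.-integrable K (EFin \o g).

Definition distributional_div (F : 'rV[R]_n -> 'rV[R]_n) g :=
  [/\ forall i, locally_integrable_rV (fun x => F x ord0 i),
      locally_integrable_rV g &
      forall phi, test_function phi ->
        (\int[mu]_x (g x * phi x)%:E =
         - \int[mu]_x (\sum_(i < n) F x ord0 i * partial i phi x)%:E)%E].

End calculus.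

Section charge_integral.
Context {d} {T : measurableType d} {R : realType}.
Variable nu : {charge set T -> \bar R}.

Let P := projT1 (cid (Hahn_decomposition nu)).
Let N := projT1 (cid (projT2 (cid (Hahn_decomposition nu)))).
Let nuPN : hahn_decomposition nu P N :=
  projT2 (cid (projT2 (cid (Hahn_decomposition nu)))).

Definition charge_integral (f : T -> \bar R) : \bar R :=
  (\int[jordan_pos nuPN]_x f x - \int[jordan_neg nuPN]_x f x)%E.

End charge_integral.

Section BV.
Context {R : realType} {n : nat}.
Implicit Types (u g : 'rV[R]_n -> R).

Local Notation mu := (@lebesgue_rV R n).

(* A finite R^n-valued measure on R^n is given by its components, which are
   charges, i.e., signed measures with values in R. *)
Local Notation vector_measure := ('I_n -> {charge set 'rV[R]_n -> \bar R}).

(* Total variation of nu: supremum of \sum_k |nu (E_k)| over the countable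
   measurable partitions (E_k) of R^n, |.| being the Euclidean norm. *)
Definition vector_measure_variation (nu : vector_measure) : \bar R :=
  ereal_sup [set (\sum_(k <oo) (enorm (\row_i fine (nu i (E k))))%:E)%E |
    E in [set E : (set 'rV[R]_n)^nat |
           [/\ forall k, measurable (E k), trivIset setT E &
               \bigcup_k E k = setT]]].

Definition distributional_gradient u (nu : vector_measure) :=
  forall (i : 'I_n) phi, test_function phi ->
    (\int[mu]_x (u x * partial i phi x)%:E =
     - charge_integral (nu i) (EFin \o phi))%E.

Definition in_BV u := mu.-integrable setT (EFin \o u) /\
  exists nu : vector_measure, distributional_gradient u nu.

Definition in_BVc u := [/\ in_BV u,
  exists M : R, \forall x \ae mu, `|u x| <= M &
  exists2 K : set 'rV[R]_n, compact K & \forall x \ae mu, ~ K x -> u x = 0].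

(* As the distributional gradient of u is unique, nu is Du below. *)
Definition in_BV_dual g := locally_integrable_rV g /\
  exists C : R, forall u (nu : vector_measure),
    in_BVc u -> distributional_gradient u nu ->
    (`|\int[mu]_x (u x * g x)%:E| <= C%:E * vector_measure_variation nu)%E.

End BV.

(* Main.v *)
Require Import Defs.
From mathcomp Require Import all_boot all_order all_algebra.
From mathcomp Require Import all_classical all_reals all_analysis.
From mathcomp Require Import measurable_realfun.
From mathcomp Require Import ring lra.

(** Let theta = |x|^(-eps). Away from the origin the radial field
    F = x |x|^-1 g(theta) has divergence
      div F = - eps |x|^(-1-eps) g'(theta) + (n-1) |x|^-1 g(theta),
    called [radial_div] below. Everything follows from this computation, used
    for g = cos, where div F is the function f of the theorem, and for
    g = - cos - (sin cos) / 2, which serves to average out the oscillation of f.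

    The identity and the duality. As eps < n-1, the weight |x|^(-1-eps) is
    locally integrable ([integral_powR_eball], a sum over dyadic shells). The
    field F is multiplied by smooth radial cutoffs vanishing near 0 and near
    infinity, built from exp(-1/t). The cutoffs are functions of k |x|^2 and of
    |x|^2 / k, and s times the derivative of such a function of s is bounded
    independently of k. The resulting test fields F_k thus satisfy
    |F_k| <= e sup|g| and |div F_k| <= C (|x|^(-1-eps) + |x|^-1) uniformly in k
    ([sum_dcut_field_le]), so that, by dominated convergence, the integral of
    u div F_k tends to that of u div F for every bounded u of compact support
    ([cvg_integral_sum_dcut_field]). If u is a test function, an integration by
    parts gives div F in the sense of distributions ([radial_divergence]). If u
    is a bounded BV function of compact support, the definition of Du applied to
    the test fields F_k bounds the integral of u div F by n e sup|g| times the
    total variation of Du ([radial_div_dual]).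

    The lower bounds, without polar coordinates. Let w = (1 + sin theta) / 2,
    which lies in [0, 1], and let b_r be a smooth bump supported in the ball of
    radius r. Then f w b_r <= f^+ on that ball, and
      f w = (eps/4) |x|^(-1-eps) - (1/2) div F
            + ((n-1)/4) |x|^-1 sin(theta) cos(theta)
    where F now is the field of the second g ([osc_sin_weight]). Against b_r the
    first term contributes at least c r^(n-1-eps), while the divergence, after
    an integration by parts, and the last term contribute O(r^(n-1))
    ([osc_lower_bound]). For small r the first term wins. This is the estimate
    of f^+ on balls, valid for every small radius, hence along r_k = r_0 / 2^k.
    It also excludes |f| from the dual, since the total variation of the
    gradient of b_r is O(r^(n-1)). *)

Set Implicit Arguments.
Unset Strict Implicit.
Unset Printing Implicit Defensive.

Import Order.TTheory GRing.Theory Num.Theory.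
Import numFieldNormedType.Exports.

Local Open Scope classical_set_scope.
Local Open Scope ring_scope.


(** * Topology and measurability of row vectors *)

Section topology_rV.
Context {R : realType} {n : nat}.
Implicit Types (x y : 'rV[R]_n) (g : 'rV[R]_n -> R).

Lemma enorm_ge0 x : 0 <= enorm x.
Proof. exact: sqrtr_ge0. Qed.

Lemma sumsq_ge0 x : 0 <= \sum_(i < n) x ord0 i ^+ 2.
Proof. by apply: sumr_ge0 => i _; exact: sqr_ge0. Qed.

Lemma sqr_enorm x : enorm x ^+ 2 = \sum_(i < n) x ord0 i ^+ 2.
Proof. by rewrite sqr_sqrtr// sumsq_ge0. Qed.

Lemma coord_le_enorm x (i : 'I_n) : `|x ord0 i| <= enorm x.
Proof.
rewrite -(ler_pXn2r (ltn0Sn 1)) ?nnegrE ?enorm_ge0//.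
rewrite real_normK ?num_real// sqr_enorm (bigD1 i)//= lerDl.
by apply: sumr_ge0 => j _; exact: sqr_ge0.
Qed.

Lemma enorm_le_sum x : enorm x <= \sum_(i < n) `|x ord0 i|.
Proof.
rewrite -(ler_pXn2r (ltn0Sn 1)) ?nnegrE ?enorm_ge0 ?sumr_ge0// sqr_enorm.
rewrite expr2 mulr_suml; apply: ler_sum => i _.
rewrite -real_normK ?num_real// expr2 ler_wpM2l//.
by rewrite (bigD1 i)//= lerDl sumr_ge0.
Qed.

Lemma continuous_sumsq : continuous (fun x => \sum_(i < n) x ord0 i ^+ 2).
Proof.
apply: continuous_big => [|i _].
  exact: add_continuous.
move=> x; apply: (continuous_comp (f := fun y : 'rV[R]_n => y ord0 i)
  (g := fun t : R => t ^+ 2)).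
  exact: coord_continuous.
exact: exprn_continuous.
Qed.

Lemma continuous_enorm : continuous (@enorm R n).
Proof.
move=> x; apply: (continuous_comp (f := fun x => \sum_(i < n) x ord0 i ^+ 2)).
  exact: continuous_sumsq.
exact: sqrt_continuous.
Qed.

Lemma enorm_eq0 x : (enorm x == 0) = (x == 0).
Proof.
apply/eqP/eqP => [x0|->]; last first.
  by rewrite /enorm big1 ?sqrtr0// => i _; rewrite mxE expr0n.
apply/rowP => i; rewrite mxE; apply/eqP; rewrite -normr_le0 -x0.
exact: coord_le_enorm.
Qed.

Lemma measurable_level (k : nat) (z : int) :
  measurable [set t : R | Num.floor (k.+1%:R * t) = z].
Proof.
rewrite (_ : mkset _ = `[z%:~R / k.+1%:R, (z + 1)%:~R / k.+1%:R[%classic)//.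
apply/seteqP; split=> t /=; rewrite in_itv/=.
  by move=> <-; rewrite ler_pdivrMr// ltr_pdivlMr// ![t * _]mulrC floor_itv.
move=> ?; apply/eqP; rewrite floor_eq.
by rewrite [_ * t]mulrC -ler_pdivrMr// -ltr_pdivlMr.
Qed.

(** The measurable sets are generated by the coordinates, so an open set has to
    be written as a countable union of boxes: the cells of the grids of mesh
    1 / (k + 1) that it contains. *)
Lemma open_measurable_rV (U : set 'rV[R]_n) : open U -> measurable U.
Proof.
move=> oU.
pose cell (kq : nat * 'rV[int]_n) := [set x : 'rV[R]_n |
  forall i, [set t | Num.floor (kq.1.+1%:R * t) = kq.2 ord0 i] (x ord0 i)].
pose F kq := if `[< cell kq `<=` U >] then cell kq else set0.
rewrite (_ : U = \bigcup_kq F kq).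
  apply: countable_bigcupT_measurable; first exact: countableP.
  move=> kq; rewrite /F; case: ifPn => // _.
  apply: (measurable_box (A := fun i =>
    [set t : R | Num.floor (kq.1.+1%:R * t) = kq.2 ord0 i])) => i.
  exact: measurable_level.
apply/seteqP; split=> [x Ux|x [kq _]]; last first.
  by rewrite /F; case: ifPn => // /asboolP; apply.
have /nbhs_ballP[e /= e0 xeU] : nbhs x U by exact: open_nbhs_nbhs.
pose k := Num.truncn e^-1.
have ke : k.+1%:R^-1 < e.
  by rewrite invf_plt ?posrE//; exact: truncnS_gt.
have xc : cell (k, \row_i Num.floor (k.+1%:R * x ord0 i)) x.
  by move=> i /=; rewrite mxE.
exists (k, \row_i Num.floor (k.+1%:R * x ord0 i)) => //.
rewrite /F ifT//; apply/asboolP => y yc; apply: xeU; split => // a i.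
rewrite !ord1 /ball /= ; apply: le_lt_trans ke.
move: (xc i) (yc i) => /= /eqP + /eqP; rewrite !floor_eq => /andP[x1 x2] /andP[y1 y2].
have k0 : 0 < k.+1%:R :> R by [].
rewrite -(ler_pM2l k0) mulfV ?gt_eqF// -[X in X * `|_|]gtr0_norm// -normrM.
rewrite mulrBr ler_norml; move: x1 x2 y1 y2; rewrite !intrD.
by set a1 := _%:~R => *; apply/andP; split; lra.
Qed.

Lemma compact_measurable_rV (K : set 'rV[R]_n) : compact K -> measurable K.
Proof.
move=> /compact_closed cK; rewrite -(setCK K); apply: measurableC.
by apply: open_measurable_rV; rewrite openC; apply: cK; exact: norm_hausdorff.
Qed.

Lemma continuous_measurable_rV g : continuous g -> measurable_fun setT g.
Proof.
move=> /continuousP cg; apply: (measurability _ (RGenOpens.measurableE R)).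
move=> _ [_ [a [b ->] <-]]; rewrite setTI; apply: open_measurable_rV.
exact/cg/interval_open.
Qed.

Lemma measurable_enorm : measurable_fun setT (@enorm R n).
Proof. by apply: continuous_measurable_rV; exact: continuous_enorm. Qed.

Lemma measurable_eball (r : R) : measurable (@eball R n r).
Proof.
rewrite (_ : eball r = @enorm R n @^-1` `]-oo, r[%classic).
  by rewrite -[X in measurable X]setTI; apply: measurable_enorm.
by apply/seteqP; split => x; rewrite /eball/= in_itv.
Qed.

(** Compact support, in a quantitative form that passes to slices, products and,
    after enlarging r, derivatives. *)
Definition vanishes_outside (r : R) g := forall x, r <= enorm x -> g x = 0.

Lemma compact_cball (r : R) : compact [set x : 'rV[R]_n | enorm x <= r].
Proof.
apply: bounded_closed_compact.
  exists r; split; first exact: num_real.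
  move=> M rM x /= xr; rewrite [leLHS]/Num.Def.normr /= mx_normrE.
  apply/bigmax_leP; split.
    by rewrite (le_trans _ (ltW rM))// (le_trans _ xr)// enorm_ge0.
  move=> [i j] _ /=; rewrite !ord1.
  by rewrite (le_trans (coord_le_enorm _ _))// (le_trans xr)// ltW.
rewrite (_ : mkset _ = @enorm R n @^-1` [set t | t <= r])//.
by apply: closed_comp => [x _|]; [exact: continuous_enorm|exact: closed_le].
Qed.

Lemma vanishes_compact_support g r : vanishes_outside r g ->
  compact (closure [set x | g x != 0]).
Proof.
move=> gr; apply: (subclosed_compact _ (@compact_cball r)).
  exact: closed_closure.
rewrite closureE => x; apply; split.
  by apply: (compact_closed _ (@compact_cball r)); exact: norm_hausdorff.
move=> y /= ; apply: contraNT; rewrite -ltNge => /ltW /gr ->.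
by rewrite eqxx.
Qed.

Lemma compact_continuous_bounded g (K : set 'rV[R]_n) : compact K ->
  continuous g -> exists2 C, 0 <= C & forall x, K x -> `|g x| <= C.
Proof.
move=> cK cg; have : compact (g @` K).
  by apply: continuous_compact => //; exact: continuous_subspaceT.
move=> /compact_bounded[M [_ hM]]; exists (`|M| + 1); first by rewrite addr_ge0.
move=> x Kx; apply: (hM (`|M| + 1)); last by exists x.
by rewrite (le_lt_trans (ler_norm M))// ltrDl.
Qed.

Lemma compact_eball (K : set 'rV[R]_n) : compact K ->
  exists2 r : R, 0 < r & K `<=` eball r.
Proof.
move=> cK; have [C C0 hC] := compact_continuous_bounded cK continuous_enorm.
exists (C + 1); first by rewrite ltr_wpDl.
move=> x Kx; rewrite /eball/= (le_lt_trans (ler_norm _))// (le_lt_trans (hC _ Kx))//.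
by rewrite ltrDl.
Qed.

Lemma compact_support_vanishes g : compact (closure [set x | g x != 0]) ->
  exists2 r, 0 < r & vanishes_outside r g.
Proof.
move=> /compact_eball[r r0 gr]; exists r => // x rx.
apply/eqP; apply: contraTT rx => gx; rewrite -ltNge.
by apply: gr; exact: subset_closure.
Qed.

Lemma vanishes_outside_bounded g r : vanishes_outside r g -> continuous g ->
  exists2 C, 0 <= C & forall x, `|g x| <= C.
Proof.
move=> gr /(compact_continuous_bounded (@compact_cball r))[C C0 hC]; exists C => // x.
have [xr|/ltW/gr->] := leP (enorm x) r; first exact: hC.
by rewrite normr0.
Qed.

End topology_rV.

(** * Integrals of partial derivatives *)

Section lines.
Context {R : realType}.

(** A directional derivative only sees the function along the line, so it is
    preserved by a map that is affine along it. This transports derivatives to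
    slices of R * R^n and to the parameter of a line. *)
Lemma is_derive_reparam (V W : normedModType R) (g : V -> R) (k : W -> V)
    (y w : W) (v : V) d :
  (forall h : R, k (h *: w + y) = h *: v + k y) ->
  is_derive (k y) v g (d : R^o) -> is_derive y w (g \o k) (d : R^o).
Proof.
move=> kE [dg gd].
have E : (fun h : R => h^-1 *: (((g \o k) \o shift y) (h *: w) - (g \o k) y)) =
         (fun h : R => h^-1 *: ((g \o shift (k y)) (h *: v) - g (k y))).
  by apply/funext => h /=; rewrite kE.
by split; [rewrite /derivable E|rewrite /derive E].
Qed.

Lemma is_derive_unique (V : normedModType R) (g : V -> R) (x v : V) (a b : R) :
  is_derive x v g (a : R^o) -> is_derive x v g (b : R^o) -> a = b.
Proof. by move=> [_ <-] [_ <-]. Qed.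

(** The derivative is given here as a value rather than by an operator, so that
    its vanishing outside the support is a matter of uniqueness. *)
Lemma is_derive_near0 (V : normedModType R) (g : V -> R) (x v : V) (a : R) :
  (\forall y \near x, g y = 0) -> is_derive x v g (a : R^o) -> a = 0.
Proof.
move=> g0 ga; apply: (is_derive_unique ga).
apply: (@near_eq_is_derive _ _ _ (cst (0 : R^o))).
by near=> y; apply/esym; near: y.
Unshelve. all: by end_near. Qed.

Lemma is_derive1_continuous (g g' : R -> R) :
  (forall s : R, is_derive s (1 : R) g (g' s : R^o)) -> continuous g.
Proof.
move=> dg s; apply: differentiable_continuous; apply/derivable1_diffP.
by have [] := dg s.
Qed.

Lemma integral_derive0 (G g : R -> R) (M : R) : 0 < M ->
  (forall t : R, is_derive t 1 G (g t : R^o)) -> continuous g ->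
  (forall t, M <= `|t| -> G t = 0) ->
  (\int[lebesgue_measure]_t (g t)%:E = 0)%E.
Proof.
move=> M0 dG cg G0.
have g0 t : M < `|t| -> g t = 0.
  move=> Mt; apply: (is_derive_near0 _ (dG t)).
  near=> s; apply: G0; apply: ltW; near: s.
  apply: (cvgr_gt `|t|) => //; exact: norm_continuous.
(* G vanishes at both ends and, by the margin 1, g vanishes outside. *)
pose I : set R := `[- (M + 1), M + 1]%classic.
transitivity (\int[lebesgue_measure]_(t in I) (g t)%:E)%E.
  rewrite [RHS]integral_mkcond; apply: eq_integral => t _.
  rewrite patchE; case: ifPn => //; rewrite notin_setE /I/= in_itv/= -ler_norml.
  move/negP; rewrite -ltNge => Mt; rewrite g0//.
  by rewrite (lt_trans _ Mt)// ltrDl.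
rewrite (@continuous_FTC2 _ g G).
- by rewrite !G0 ?subee// ?normrN ger0_norm ?addr_ge0 ?lerDl ?ltW.
- by rewrite gtrN// addr_gt0.
- exact: continuous_subspaceT.
- have cG := is_derive1_continuous dG.
  split.
  + by move=> t _; exact: ex_derive.
  + exact/cvg_at_right_filter/cG.
  + exact/cvg_at_left_filter/cG.
- by move=> t _; rewrite derive1E; exact: derive_val.
Unshelve. all: by end_near. Qed.

End lines.

Section measure_rV.
Context {R : realType} {n : nat}.
Implicit Types (x y : 'rV[R]_n) (g : 'rV[R]_n -> R).
Local Notation mu := (@lebesgue_rV R n).

(** Neighborhoods are balls of the sup norm, and there are finitely many
    coordinates. *)
Lemma continuous_to_rV (W : topologicalType) (k : W -> 'rV[R]_n) :
  (forall i, continuous (fun w => k w ord0 i)) -> continuous k.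
Proof.
move=> ck w; apply/cvg_ballP => e e0.
have H : \forall w' \near w, forall i, ball (k w ord0 i) e (k w' ord0 i).
  apply: filter_forall => i.
  by move: (ck i w) => /cvg_ballP/(_ _ e0).
by near=> w'; split=> // i j; rewrite !ord1; move: j; near: w'.
Unshelve. all: by end_near. Qed.

Lemma lebesgue_cube (r : R) : 0 < r ->
  mu [set x | forall i, `]-r, r[%classic (x ord0 i)] = ((2 * r) ^+ n)%:E.
Proof.
move=> r0; rewrite (lebesgue_rV_box (A := fun=> `]-r, r[%classic))//.
under eq_bigr do rewrite lebesgue_measure_itv/= lte_fin gtrN// -EFinD opprK.
by rewrite prodEFin prodr_const card_ord -mulr2n -[X in X ^+ _]mulr_natl.
Qed.

Lemma measurable_cube (r : R) :
  measurable [set x : 'rV[R]_n | forall i, `]-r, r[%classic (x ord0 i)].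
Proof. exact: (measurable_box (A := fun=> `]-r, r[%classic)). Qed.

Lemma eball_measure_le (r : R) : 0 < r -> (mu (eball r) <= ((2 * r) ^+ n)%:E)%E.
Proof.
move=> r0; rewrite -lebesgue_cube//; apply: le_measure; rewrite ?inE.
- exact: measurable_eball.
- exact: measurable_cube.
move=> x xr i; rewrite /= in_itv/= -ltr_norml.
exact: le_lt_trans (coord_le_enorm _ _) xr.
Qed.

Lemma eball_measure_fin (r : R) : (mu (eball r) < +oo)%E.
Proof.
apply: (@le_lt_trans _ _ (mu (eball (`|r| + 1)))).
  apply: le_measure; rewrite ?inE; [exact: measurable_eball..|].
  move=> x; rewrite /eball /= => /lt_le_trans; apply.
  by rewrite (le_trans (ler_norm _))// lerDl.
by rewrite (le_lt_trans (eball_measure_le _))// ?ltry// ltr_wpDl.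
Qed.

Lemma integrable_bounded_support g (C r : R) : measurable_fun setT g ->
  vanishes_outside r g -> (forall x, `|g x| <= C) ->
  mu.-integrable setT (EFin \o g).
Proof.
move=> mg gr gC.
apply: (@le_integrable _ _ _ _ _ _ _ (fun x => (C * \1_(eball r) x)%:E)) => //.
- exact/measurable_EFinP.
- move=> x _ /=; rewrite lee_fin; have [xr|/gr ->] := ltP (enorm x) r.
    by rewrite indicE mem_set// mulr1 (le_trans (gC x))// ler_norm.
  by rewrite normr0.
apply: (eq_integrable _ (fun x => (C%:E * (\1_(eball r) x)%:E)%E)) => //.
apply: integrableZl => //; apply/integrableP; split.
  by apply/measurable_EFinP; apply: measurable_indic; exact: measurable_eball.
under eq_integral do rewrite /= ger0_norm//.
rewrite integral_indic ?setIT//; [exact: eball_measure_fin|exact: measurable_eball].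
Qed.

Lemma partial_vanishes (v : 'rV[R]_n) (g g' : 'rV[R]_n -> R) (r : R) :
  vanishes_outside r g -> (forall x, is_derive x v g (g' x : R^o)) ->
  forall x, r < enorm x -> g' x = 0.
Proof.
move=> gr dg x rx; apply: (is_derive_near0 _ (dg x)).
near=> y; apply/gr/ltW; near: y.
by apply: (cvgr_gt (enorm x)) => //; exact: continuous_enorm.
Unshelve. all: by end_near. Qed.

Lemma partial_vanishes_outside (v : 'rV[R]_n) (g g' : 'rV[R]_n -> R) (r : R) :
  vanishes_outside r g -> (forall x, is_derive x v g (g' x : R^o)) ->
  vanishes_outside (r + 1) g'.
Proof.
move=> gr dg x rx; apply: (partial_vanishes gr dg).
by rewrite (lt_le_trans _ rx)// ltrDl.
Qed.

Lemma integrable_continuous_support g r : continuous g -> vanishes_outside r g ->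
  mu.-integrable setT (EFin \o g).
Proof.
move=> cg gr; have [C _ gC] := vanishes_outside_bounded gr cg.
by apply: (integrable_bounded_support _ gr gC); exact: continuous_measurable_rV.
Qed.

End measure_rV.

Section cons_continuous.
Context {R : realType} {n : nat}.

Lemma continuous_cons_l (y : 'rV[R]_n) :
  continuous (fun a : R => cons_rV (a, y) : 'rV[R]_n.+1).
Proof.
apply: continuous_to_rV => i; case: (unliftP ord0 i) => [j|] -> a.
  under eq_fun do rewrite cons_rVS.
  exact: cvg_cst.
under eq_fun do rewrite cons_rV0.
exact: cvg_id.
Qed.

Lemma continuous_cons_r (a : R) :
  continuous (fun y : 'rV[R]_n => cons_rV (a, y) : 'rV[R]_n.+1).
Proof.
apply: continuous_to_rV => i; case: (unliftP ord0 i) => [j|] -> y.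
  under eq_fun do rewrite cons_rVS.
  exact: coord_continuous.
under eq_fun do rewrite cons_rV0.
exact: (@cst_continuous _ _ a y).
Qed.

Lemma enorm_cons (a : R) (y : 'rV[R]_n) :
  enorm (cons_rV (a, y)) ^+ 2 = a ^+ 2 + enorm y ^+ 2.
Proof.
rewrite !sqr_enorm big_ord_recl cons_rV0; congr (_ + _).
by apply: eq_bigr => i _; rewrite cons_rVS.
Qed.

Lemma enorm_cons_ger (a : R) (y : 'rV[R]_n) : enorm y <= enorm (cons_rV (a, y)).
Proof.
rewrite -(ler_pXn2r (ltn0Sn 1)) ?nnegrE ?enorm_ge0// enorm_cons lerDr.
exact: sqr_ge0.
Qed.

Lemma cons_rVD0 (a h : R) (y : 'rV[R]_n) :
  cons_rV (h + a, y) = h *: delta_mx ord0 ord0 + cons_rV (a, y).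
Proof.
apply/rowP => i; rewrite [RHS]mxE [X in _ = X + _]mxE [delta_mx _ _ _ _]mxE.
case: (unliftP ord0 i) => [j|] ->.
  by rewrite !cons_rVS/= mulr0 add0r.
by rewrite !cons_rV0 mulr1.
Qed.

Lemma cons_rVDS (a h : R) (j : 'I_n) (y : 'rV[R]_n) :
  cons_rV (a, h *: delta_mx ord0 j + y) =
  h *: delta_mx ord0 (lift ord0 j) + cons_rV (a, y).
Proof.
apply/rowP => i; rewrite [RHS]mxE [X in _ = X + _]mxE [delta_mx _ _ _ _]mxE.
case: (unliftP ord0 i) => [l|] ->.
  by rewrite !cons_rVS !mxE (inj_eq (@lift_inj _ ord0)).
by rewrite !cons_rV0/= mulr0 add0r.
Qed.

End cons_continuous.

Section integral_partial.
Context {R : realType}.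

Lemma integral_lebesgue_rVS (n : nat) (f : 'rV[R]_n.+1 -> \bar R) :
  (@lebesgue_rV R n.+1).-integrable setT f ->
  ((lebesgue_measure \x @lebesgue_rV R n)%E).-integrable setT (f \o @cons_rV R n)
  /\ (\int[@lebesgue_rV R n.+1]_x f x =
      \int[(lebesgue_measure \x @lebesgue_rV R n)%E]_p f (cons_rV p))%E.
Proof.
move=> /integrableP[mf intf].
have mc := @measurable_cons_rV R n.
have i1 : ((lebesgue_measure \x @lebesgue_rV R n)%E).-integrable setT (f \o @cons_rV R n).
  apply/integrableP; split; first exact: measurableT_comp.
  move: intf; rewrite [X in (X < _)%E](_ : _ =
    (\int[pushforward ((lebesgue_measure \x @lebesgue_rV R n)%E) (@cons_rV R n)]_x
      `|f x|)%E)//.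
  rewrite ge0_integral_pushforward//.
  exact: measurableT_comp.
split => //.
exact: (integral_pushforward mc mf i1 measurableT).
Qed.

(** Fubini: the 0-th derivative is integrated over the first factor by the
    fundamental theorem of calculus, any other one over the second factor by
    induction on the dimension. *)
Lemma integral_partial0 n (i : 'I_n) (g g' : 'rV[R]_n -> R) (r : R) :
  (forall x, is_derive x (delta_mx ord0 i) g (g' x : R^o)) ->
  continuous g' -> vanishes_outside r g ->
  (\int[@lebesgue_rV R n]_x (g' x)%:E = 0)%E.
Proof.
elim: n i g g' => [[]//|n IH] i g g' dg cg' gr.
have g'r := partial_vanishes_outside gr dg.
have [i1 ->] := integral_lebesgue_rVS (integrable_continuous_support cg' g'r).
case: (unliftP ord0 i) dg => [j|] -> dg.
  rewrite -(integral12_prod_meas1 i1); apply: integral0_eq => a _.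
  apply: (IH j (fun y => g (cons_rV (a, y))) (fun y => g' (cons_rV (a, y)))).
  - move=> y; apply: (is_derive_reparam (v := delta_mx ord0 (lift ord0 j)) _ (dg _)).
    by move=> h; rewrite cons_rVDS.
  - move=> y; apply: continuous_comp; last exact: cg'.
    exact: continuous_cons_r.
  - by move=> y ry; apply: gr; rewrite (le_trans ry)// enorm_cons_ger.
rewrite -(integral21_prod_meas1 i1); apply: integral0_eq => y _.
apply: (@integral_derive0 _ (fun a => g (cons_rV (a, y))) _ (`|r| + 1)).
- by rewrite ltr_wpDl.
- move=> a; apply: (is_derive_reparam (v := delta_mx ord0 ord0) _ (dg _)).
  by move=> h; rewrite -cons_rVD0 [h *: _]mulr1.
- move=> a; apply: continuous_comp; last exact: cg'.
  exact: continuous_cons_l.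
- move=> a ra; apply: gr.
  have := coord_le_enorm (cons_rV (a, y)) ord0; rewrite cons_rV0/=; apply: le_trans.
  by rewrite (le_trans _ ra)// (le_trans (ler_norm _))// lerDl.
Qed.

End integral_partial.

(** * Integrals of powers of the norm over balls *)

Section power_integral.
Context {R : realType} {n : nat}.
Implicit Types (x y : 'rV[R]_n).
Local Notation mu := (@lebesgue_rV R n).

Lemma measurable_enorm_powR (p : R) : measurable_fun setT (fun x => enorm x `^ p).
Proof. exact: (measurableT_comp (measurable_powR p) measurable_enorm). Qed.

Lemma dyadic_shell (r t : R) : 0 < t -> t < r ->
  exists2 k : nat, r / 2 ^+ k.+1 <= t & t < r / 2 ^+ k.
Proof.
move=> t0 tr; have r0 : 0 < r by exact: lt_trans tr.
have ex : exists k : nat, r / 2 ^+ k.+1 <= t.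
  exists (Num.truncn (r / t)).
  rewrite ler_pdivrMr ?exprn_gt0// mulrC -ler_pdivrMr//.
  apply/ltW/(lt_le_trans (truncnS_gt _)).
  by rewrite -natrX ler_nat ltnW// ltn_expl.
case: (ex_minnP ex) => k kt kmin; exists k => //.
case: k kt kmin => [|k] kt kmin; first by rewrite expr0 divr1.
by rewrite ltNge; apply/negP => /kmin; rewrite ltnn.
Qed.

Lemma nneseries_geometric (A q : R) : 0 <= q -> q < 1 ->
  (\sum_(0 <= k <oo) (A * q ^+ k)%:E = (A / (1 - q))%:E)%E.
Proof.
move=> q0 q1; apply/cvg_lim => //.
under eq_fun do rewrite sumEFin.
apply: cvg_EFin; first by apply: nearW.
by apply: cvg_geometric_series; rewrite ger0_norm.
Qed.

Lemma powR_expR (s p : R) : 0 < s -> s `^ p = expR (p * ln s).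
Proof. by move=> s0; rewrite /powR gt_eqF. Qed.

Lemma powR_shell_term (a r : R) (k : nat) : 0 < r ->
  (r / 2 ^+ k.+1) `^ (- a) * (2 * (r / 2 ^+ k)) ^+ n =
  (2 `^ (a + n%:R)) * r `^ (n%:R - a) * (2 `^ (a - n%:R)) ^+ k.
Proof.
move=> r0; have two0 : (0 : R) < 2 by [].
have rk m : 0 < r / 2 ^+ m by rewrite divr_gt0// exprn_gt0.
have lnrk m : ln (r / 2 ^+ m) = ln r - m%:R * ln 2.
  by rewrite ln_div ?posrE ?exprn_gt0// lnXn// mulr_natl.
rewrite -[X in _ * X = _]powR_mulrn ?mulr_ge0 ?ltW//.
rewrite -[X in _ = _ * X]powR_mulrn ?powR_ge0//.
rewrite !powR_expR ?mulr_gt0 ?expR_gt0// -!expRD; congr expR.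
by rewrite [ln (2 * _)]lnM ?posrE// !lnrk expRK -natr1; ring.
Qed.

(** On the shell r / 2^(k+1) <= |x| < r / 2^k, of measure at most
    (2 r / 2^k)^n, the power is at most its value at the inner radius. The
    resulting series is geometric of ratio 2^(a - n). *)
Lemma integral_powR_eball (a : R) : 0 < a -> a < n%:R ->
  exists2 C : R, 0 <= C & forall r : R, 0 < r ->
    (\int[mu]_(x in eball r) (enorm x `^ (- a))%:E <= (C * r `^ (n%:R - a))%:E)%E.
Proof.
move=> a0 an; set q := 2 `^ (a - n%:R) : R.
have q0 : 0 <= q by exact: powR_ge0.
have q1 : q < 1.
  have ln20 : 0 < ln 2 :> R by rewrite ln_gt0// ltr1n.
  by rewrite /q powR_expR// -[X in _ < X]expR0 ltr_expR pmulr_llt0// subr_lt0.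
exists (2 `^ (a + n%:R) / (1 - q)).
  by rewrite divr_ge0 ?powR_ge0// subr_ge0 ltW.
move=> r r0.
pose c k : R := (r / 2 ^+ k.+1) `^ (- a).
pose b k : set 'rV[R]_n := eball (r / 2 ^+ k).
have mb k : measurable (b k) by exact: measurable_eball.
have rk k : 0 < r / 2 ^+ k by rewrite divr_gt0// exprn_gt0.
apply: (@le_trans _ _ (\int[mu]_x (\sum_(0 <= k <oo) (c k * \1_(b k) x)%:E))%E).
  rewrite integral_mkcond; apply: ge0_le_integral => //.
  - by move=> x _; rewrite patchE; case: ifPn => // _; rewrite lee_fin powR_ge0.
  - apply/(measurable_restrictT _ (measurable_eball r)).
    by apply/measurable_EFinP; apply: measurable_funTS; exact: measurable_enorm_powR.
  - apply: ge0_emeasurable_sum => [k x _ _|k _].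
      by rewrite lee_fin mulr_ge0 ?powR_ge0.
    by apply/measurable_EFinP; apply: measurable_funM.
  move=> x _; rewrite patchE; case: ifPn => [|_]; last first.
    apply: nneseries_ge0 => k _ _.
    by rewrite lee_fin mulr_ge0 ?powR_ge0.
  rewrite inE /eball /= => xr.
  have [/eqP x0|x0] := eqVneq (enorm x) 0.
    rewrite (eqP x0) powR0 ?oppr_eq0 ?gt_eqF//.
    by apply: nneseries_ge0 => k _ _; rewrite lee_fin mulr_ge0 ?powR_ge0.
  have {}x0 : 0 < enorm x by rewrite lt_neqAle eq_sym x0 enorm_ge0.
  have [k kx xk] := dyadic_shell x0 xr.
  have cb0 j : (0 <= (c j * \1_(b j) x)%:E)%E by rewrite lee_fin mulr_ge0 ?powR_ge0.
  apply: (@le_trans _ _ (\sum_(0 <= j < k.+1) (c j * \1_(b j) x)%:E)%E).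
    rewrite big_nat_recr//= -[leLHS]add0e; apply: leeD; first exact: sume_ge0.
    rewrite lee_fin indicE mem_set// mulr1 /c.
    by rewrite !powRN lef_pV2 ?posrE ?powR_gt0// ge0_ler_powR// ?nnegrE ?ltW.
  by apply: nneseries_lim_ge => j _ _.
rewrite integral_nneseries//=; last 2 first.
- by move=> k; apply/measurable_EFinP; apply: measurable_funM.
- by move=> k x _; rewrite lee_fin mulr_ge0 ?powR_ge0.
rewrite mulrAC -nneseries_geometric//; apply: lee_nneseries => [k _ _|k _].
  by apply: integral_ge0 => x _; rewrite lee_fin mulr_ge0 ?powR_ge0.
rewrite /= -powR_shell_term//.
under eq_integral do rewrite EFinM.
rewrite ge0_integralZl ?lee_fin ?powR_ge0//; last first.
  by apply/measurable_EFinP.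
rewrite integral_indic// setIT EFinM lee_wpmul2l ?lee_fin ?powR_ge0//.
exact: eball_measure_le.
Qed.

End power_integral.

(** * Smooth functions of one variable *)

Section smooth_line.
Context {R : realType}.
Implicit Types (U V : set R) (f g h w : R -> R).

(** Derivatives are quantified existentially, each only on U. Then the closure
    properties are inductions on m that never compare two derivative
    operators. *)
Fixpoint ndiff_on U (m : nat) h : Prop :=
  if m is m'.+1 then
    exists2 h', (forall s, U s -> is_derive s (1 : R) h (h' s : R^o)) & ndiff_on U m' h'
  else True.

Lemma ndiff_onW U m h : ndiff_on U m.+1 h -> ndiff_on U m h.
Proof.
elim: m h => [//|m IH] h [h' dh Dh]; exists h' => //.
exact: IH.
Qed.

Lemma ndiff_on_cst U m (c : R) : ndiff_on U m (fun=> c).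
Proof.
by elim: m c => [//|m IH] c; exists (fun=> 0) => // s _; exact: is_derive_cst.
Qed.

Lemma ndiff_onD U m f g : ndiff_on U m f -> ndiff_on U m g ->
  ndiff_on U m (fun s => f s + g s).
Proof.
elim: m f g => [//|m IH] f g [f' df Df] [g' dg Dg].
exists (fun s => f' s + g' s); last exact: IH.
by move=> s Us; apply: is_deriveD; [exact: df|exact: dg].
Qed.

Lemma ndiff_onM U m f g : ndiff_on U m f -> ndiff_on U m g ->
  ndiff_on U m (fun s => f s * g s).
Proof.
elim: m f g => [//|m IH] f g fD gD.
have [f' df Df] := fD; have [g' dg Dg] := gD.
exists (fun s => f s * g' s + g s * f' s).
  by move=> s Us; apply: is_deriveM; [exact: df|exact: dg].
by apply: ndiff_onD; apply: IH => //; exact: ndiff_onW.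
Qed.

Lemma ndiff_on_comp U V m f g : (forall s, U s -> V (g s)) ->
  ndiff_on V m f -> ndiff_on U m g -> ndiff_on U m (fun s => f (g s)).
Proof.
move=> UV; elim: m f g UV => [//|m IH] f g UV fD gD.
have [f' df Df] := fD; have [g' dg Dg] := gD.
exists (fun s => f' (g s) * g' s).
  move=> s Us; apply: (is_derive1_comp (f := f) (g := g)); last exact: dg.
  exact/df/UV.
by apply: ndiff_onM => //; apply: IH => //; exact: ndiff_onW.
Qed.

Lemma ndiff_on_cos_sin U m : ndiff_on U m (@cos R) /\ ndiff_on U m (@sin R).
Proof.
elim: m => [//|m [IHc IHs]]; split.
  exists (fun s => -1 * sin s); last by apply: ndiff_onM => //; exact: ndiff_on_cst.
  by move=> s _; rewrite mulN1r; exact: is_derive_cos.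
by exists (@cos R) => // s _; exact: is_derive_sin.
Qed.

Lemma ndiff_on_powR m (a : R) : ndiff_on [set s | 0 < s] m (fun s => s `^ a).
Proof.
elim: m a => [//|m IH] a; exists (fun s => a * s `^ (a - 1)).
  by move=> s s0; exact: is_derive1_powR.
by apply: ndiff_onM; [exact: ndiff_on_cst|exact: IH].
Qed.

Lemma ndiff_on_affine U m (a b : R) : ndiff_on U m (fun s => a * s + b).
Proof.
apply: ndiff_onD; last exact: ndiff_on_cst.
apply: ndiff_onM; first exact: ndiff_on_cst.
case: m => [//|m]; exists (fun=> 1); last exact: ndiff_on_cst.
by move=> s _; exact: is_derive_id.
Qed.

(** The functions t^(-k) exp(-1/t), extended by 0 to t <= 0. Multiplying by
    powers of 1/t is what makes the family stable by differentiation. *)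
Definition flat (k : nat) (t : R) : R :=
  if 0 < t then t^-1 ^+ k * expR (- t^-1) else 0.

Lemma flat_le0 k t : t <= 0 -> flat k t = 0.
Proof. by rewrite /flat ltNge => ->. Qed.

Lemma flat_ge0 k t : 0 <= flat k t.
Proof.
rewrite /flat; case: ifPn => // t0.
by rewrite mulr_ge0 ?expR_ge0// exprn_ge0// invr_ge0 ltW.
Qed.

(** exp v = exp (v / k)^k >= (1 + v / k)^k >= (v / k)^k. *)
Lemma expr_le_expR k : exists2 C : R, 0 < C & forall v, 0 <= v -> v ^+ k <= C * expR v.
Proof.
case: k => [|k].
  by exists 1 => // v v0; rewrite expr0 mul1r -[leLHS]expR0 ler_expR.
exists (k.+1%:R ^+ k.+1); first by rewrite exprn_gt0.
move=> v v0; have -> : expR v = expR (v / k.+1%:R) ^+ k.+1.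
  by rewrite -expRM_natl mulrC divfK// pnatr_eq0.
rewrite -exprMn lerXn2r ?nnegrE ?mulr_ge0 ?expR_ge0//.
rewrite -ler_pdivrMl// mulrC (le_trans _ (expR_ge1Dx _))// lerDr//.
Qed.

Lemma flat_le k : exists2 C : R, 0 < C & forall t, flat k t <= C.
Proof.
have [C C0 hC] := expr_le_expR k; exists C => // t.
rewrite /flat; case: ifPn => [t0|_]; last exact: ltW.
by rewrite expRN ler_pdivrMr ?expR_gt0// hC// invr_ge0 ltW.
Qed.

Lemma flatS k t : flat k t = t * flat k.+1 t.
Proof.
rewrite /flat; case: ifPn => [t0|_]; last by rewrite mulr0.
by rewrite exprS !mulrA mulfV ?gt_eqF// mul1r.
Qed.

(** At 0 the difference quotient is h times a bounded function, since
    flat k h = h^2 flat (k+2) h. *)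
Lemma is_derive_flat k (t : R) :
  is_derive t (1 : R) (flat k) (flat k.+2 t - k%:R * flat k.+1 t : R^o).
Proof.
have [t0|t0|->] := ltgtP t 0.
- rewrite !flat_le0 ?ltW// mulr0 subr0.
  apply: (@near_eq_is_derive _ _ _ (cst (0 : R^o))).
  near=> s; rewrite flat_le0 ?ltW//; near: s.
  exact: lt_nbhsl.
- apply: (@near_eq_is_derive _ _ _ (fun s : R => s^-1 ^+ k * expR (- s^-1))).
    near=> s; rewrite /flat ifT//; near: s.
    exact: lt_nbhsr.
  have dV : is_derive t 1 (fun s : R => s^-1) (- t^-1 ^+ 2 : R^o).
    apply: is_derive_eq; first by apply: is_deriveV; rewrite gt_eqF.
    by rewrite /GRing.scale/= mulr1 exprVn.
  have dE : is_derive t 1 (fun s : R => expR (- s^-1))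
    (- - t^-1 ^+ 2 * expR (- t^-1) : R^o).
    by apply: is_derive_eq; rewrite mulrC.
  have := is_deriveM (is_deriveX k dV) dE; rewrite exprfctE => dM.
  apply: (is_derive_eq dM).
  rewrite /flat t0 /GRing.scale/=; case: (k) => [|j] /=; rewrite ?exprS; ring.
- rewrite !flat_le0// mulr0 subr0.
  have [C C0 hC] := flat_le k.+2.
  have H : (fun h : R =>
      h^-1 *: ((flat k \o shift (0 : R)) (h *: (1 : R)) - flat k 0 : R^o)) @ 0^' --> (0 : R^o).
    apply/cvgr0Pnorm_le => e e0; near=> h => /=.
    rewrite addr0 (flat_le0 _ (lexx 0)) subr0 [h *: _]mulr1 /GRing.scale/=.
    have h0 : h != 0 by near: h; exact: nbhs_dnbhs_neq.
    rewrite 2!flatS !mulrA mulVf// mul1r normrM (ger0_norm (flat_ge0 _ _)).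
    rewrite (le_trans (ler_wpM2l _ (hC _)))// -ler_pdivlMr//.
    near: h; apply: dnbhs0_le; by rewrite divr_gt0.
  by split; [apply/cvg_ex; exists 0|apply/cvg_lim].
Unshelve. all: by end_near. Qed.

Lemma ndiff_on_flat U m k : ndiff_on U m (flat k).
Proof.
elim: m k => [//|m IH] k; exists (fun t => flat k.+2 t + (- k%:R) * flat k.+1 t).
  by move=> t _; rewrite mulNr; exact: is_derive_flat.
by apply: ndiff_onD => //; apply: ndiff_onM => //; exact: ndiff_on_cst.
Qed.

(** The product is differentiable on the whole line although w is so only on the
    positive half-line: the factor vanishes for s <= 1/c, and so does the
    right-hand side, whatever w and w' are there. *)
Lemma is_derive_flat_mul k (c : R) w w' (s : R) : 0 < c ->
  (0 < s -> is_derive s (1 : R) w (w' s : R^o)) ->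
  is_derive s (1 : R) (fun s => flat k (c * s - 1) * w s)
    (flat k (c * s - 1) * w' s +
     c * (flat k.+2 (c * s - 1) - k%:R * flat k.+1 (c * s - 1)) * w s : R^o).
Proof.
move=> c0 dw; have [s0|s0] := ltP 0 s.
  have dc : is_derive s (1 : R) (fun s : R => flat k (c * s - 1))
      ((flat k.+2 (c * s - 1) - k%:R * flat k.+1 (c * s - 1)) * c : R^o).
    apply: (is_derive1_comp (f := flat k) (g := fun s => c * s - 1)).
      exact: is_derive_flat.
    apply: is_derive_eq.
    by rewrite subr0 [LHS]mulr1.
  apply: (is_derive_eq (is_deriveM dc (dw s0))).
  by rewrite /GRing.scale/=; ring.
have cs z : z < c^-1 -> c * z - 1 <= 0.
  by move=> zc; rewrite subr_le0 -ler_pdivlMl// mulr1 ltW.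
have sc : s < c^-1 by rewrite (le_lt_trans s0)// invr_gt0.
rewrite !flat_le0 ?cs// mulr0 subr0 mulr0 !mul0r addr0.
apply: (@near_eq_is_derive _ _ _ (cst (0 : R^o))).
near=> z; rewrite flat_le0 ?mul0r// cs//; near: z.
exact: lt_nbhsl.
Unshelve. all: by end_near. Qed.

Lemma ndiff_on_flat_mul m k (c : R) w : 0 < c -> ndiff_on [set s | 0 < s] m w ->
  ndiff_on setT m (fun s => flat k (c * s - 1) * w s).
Proof.
move=> c0; elim: m k w => [//|m IH] k w wD; have [w' dw Dw] := wD.
exists (fun s => flat k (c * s - 1) * w' s +
  c * (flat k.+2 (c * s - 1) * w s + (- k%:R) * (flat k.+1 (c * s - 1) * w s))).
  move=> s _; apply: (is_derive_eq (is_derive_flat_mul k c0 (dw s))).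
  by ring.
apply: ndiff_onD; first exact: IH.
apply: ndiff_onM; first exact: ndiff_on_cst.
apply: ndiff_onD; first by apply: IH; exact: ndiff_onW.
by apply: ndiff_onM; [exact: ndiff_on_cst|apply: IH; exact: ndiff_onW].
Qed.

End smooth_line.

(** * Smooth functions of several variables *)

Section smooth_rV.
Context {R : realType} {n : nat}.
Implicit Types (f g : 'rV[R]_n -> R).

(** Continuous, with m successive continuous partial derivatives in each
    direction. As in [ndiff_on], the derivatives are existential. *)
Fixpoint Ck (m : nat) g : Prop :=
  if m is m'.+1 then continuous g /\ forall i : 'I_n,
    exists2 g', (forall x, is_derive x (delta_mx ord0 i) g (g' x : R^o)) & Ck m' g'
  else continuous g.

Lemma Ck_continuous m g : Ck m g -> continuous g.
Proof. by case: m => [//|m []]. Qed.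

Lemma CkW m g : Ck m.+1 g -> Ck m g.
Proof.
elim: m g => [|m IH] g [cg dg] //; split=> // i.
by have [g' ? ?] := dg i; exists g' => //; exact: IH.
Qed.

Lemma Ck_cst m (c : R) : Ck m (fun=> c).
Proof.
elim: m c => [|m IH] c; first exact: cst_continuous.
split; first exact: cst_continuous.
by move=> i; exists (fun=> 0) => // x; exact: is_derive_cst.
Qed.

Lemma CkD m f g : Ck m f -> Ck m g -> Ck m (fun x => f x + g x).
Proof.
elim: m f g => [|m IH] f g.
  by move=> cf cg x; apply: continuousD; [exact: cf|exact: cg].
move=> [cf df] [cg dg]; split.
  by move=> x; apply: continuousD; [exact: cf|exact: cg].
move=> i; have [f' df' Df'] := df i; have [g' dg' Dg'] := dg i.
exists (fun x => f' x + g' x); last exact: IH.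
by move=> x; exact: is_deriveD.
Qed.

Lemma CkM m f g : Ck m f -> Ck m g -> Ck m (fun x => f x * g x).
Proof.
elim: m f g => [|m IH] f g.
  by move=> cf cg x; apply: continuousM; [exact: cf|exact: cg].
move=> fD gD; have [cf df] := fD; have [cg dg] := gD; split.
  by move=> x; apply: continuousM; [exact: cf|exact: cg].
move=> i; have [f' df' Df'] := df i; have [g' dg' Dg'] := dg i.
exists (fun x => f x * g' x + g x * f' x).
  by move=> x; exact: is_deriveM.
by apply: CkD; apply: IH => //; exact: CkW.
Qed.

Lemma Ck_sum m (I : Type) (r : seq I) (F : I -> 'rV[R]_n -> R) :
  (forall k, Ck m (F k)) -> Ck m (fun x => \sum_(k <- r) F k x).
Proof.
move=> DF; elim: r => [|k r IH].
  by under eq_fun do rewrite big_nil; exact: Ck_cst.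
by under eq_fun do rewrite big_cons; exact: CkD.
Qed.

Lemma is_derive_coord (i : 'I_n) (x v : 'rV[R]_n) :
  is_derive x v (fun y : 'rV[R]_n => y ord0 i) (v ord0 i : R^o).
Proof.
have H : (fun h : R => h^-1 *: (((fun y : 'rV[R]_n => y ord0 i) \o shift x) (h *: v)
    - x ord0 i : R^o)) @ 0^' --> (v ord0 i : R^o).
  apply: (@cvg_trans _ (nbhs (cst (v ord0 i : R^o) @ (0 : R)^'))); last exact: cvg_cst.
  apply: near_eq_cvg; near=> h; rewrite /= !mxE addrK scalerA mulVf ?scale1r//.
  by near: h; exact: nbhs_dnbhs_neq.
by split; [apply/cvg_ex; exists (v ord0 i)|apply/cvg_lim].
Unshelve. all: by end_near. Qed.

Lemma Ck_coord m (i : 'I_n) : Ck m (fun x => x ord0 i).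
Proof.
case: m => [|m]; first exact: coord_continuous.
split; first exact: coord_continuous.
move=> j; exists (fun=> (delta_mx ord0 j : 'rV[R]_n) ord0 i); last exact: Ck_cst.
by move=> x; exact: is_derive_coord.
Qed.

(** The one-variable chain rule, applied on the line through x directed by v. *)
Lemma is_derive_comp_line (h : R -> R) g (x v : 'rV[R]_n) (a b : R) :
  is_derive (g x) (1 : R) h (a : R^o) -> is_derive x v g (b : R^o) ->
  is_derive x v (fun y => h (g y)) (a * b : R^o).
Proof.
move=> dh dg; pose k (s : R) := s *: v + x.
have k0 : k 0 = x by rewrite /k scale0r add0r.
have dgk : is_derive (0 : R) (1 : R) (g \o k) (b : R^o).
  apply: (is_derive_reparam (v := v)); last by rewrite k0.
  by move=> s; rewrite k0 /k addr0 [s *: _]mulr1.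
have [d1 d2] : is_derive (0 : R) (1 : R) (h \o (g \o k)) (a * b : R^o).
  by apply: is_derive1_comp; rewrite /= k0.
have E : (fun s : R => s^-1 *: ((h \o (g \o k) \o shift (0 : R)) (s *: (1 : R)) -
    (h \o (g \o k)) 0 : R^o)) =
  (fun s : R => s^-1 *: (((fun y => h (g y)) \o shift x) (s *: v) - h (g x) : R^o)).
  by apply/funext => s; rewrite /= k0 /k addr0 [s *: (1 : R)]mulr1.
by split; [rewrite /derivable -E|rewrite /derive -E].
Qed.

Lemma Ck_comp m h g : ndiff_on setT m.+1 h -> Ck m g -> Ck m (fun x => h (g x)).
Proof.
elim: m h g => [|m IH] h g hD gD.
  have [h' dh _] := hD; move=> x; apply: continuous_comp; first exact: gD.
  by apply: is_derive1_continuous => s; exact: dh.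
split.
  have [h' dh _] := hD; move=> x; apply: continuous_comp; first exact: (Ck_continuous gD).
  by apply: is_derive1_continuous => s; exact: dh.
have [h' dh Dh] := hD; have [_ dg] := gD.
move=> i; have [g' dg' Dg'] := dg i.
exists (fun x => h' (g x) * g' x).
  by move=> x; exact: (is_derive_comp_line (dh (g x) I) (dg' x)).
by apply: CkM => //; apply: IH => //; exact: CkW.
Qed.

Lemma Ck_smooth g : (forall m, Ck m g) -> smooth g.
Proof.
move=> gD s /=.
suff sD m : Ck m (foldr partial g s).
  split; first exact: (Ck_continuous (sD 0%N)).
  by move=> i x; have [_ /(_ i)[g' /(_ x)[]]] := sD 1%N.
elim: s m => [|i s IH] m /=; first exact: gD.
have [_ /(_ i)[g' dg' Dg']] := IH m.+1.
rewrite (_ : partial i _ = g')//; apply/funext => x.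
by have [_] := dg' x.
Qed.

Lemma smooth_is_derive g (i : 'I_n) : smooth g ->
  forall x, is_derive x (delta_mx ord0 i) g (partial i g x : R^o).
Proof. by move=> /(_ [::])[_ dg] x; split => //; exact: dg. Qed.

Lemma smooth_continuous g : smooth g -> continuous g.
Proof. by move=> /(_ [::])[]. Qed.

Lemma smooth_continuous_partial g (i : 'I_n) : smooth g -> continuous (partial i g).
Proof. by move=> /(_ [:: i])[]. Qed.

End smooth_rV.

(** * Radial profiles and cutoffs *)

Section profile.
Context {R : realType}.
Variables (eps : R) (g g' : R -> R).
Hypothesis Dg : forall m, ndiff_on setT m g.
Hypothesis dg : forall s, is_derive s (1 : R) g (g' s : R^o).
Implicit Types (c s t : R) (k : nat).

(** With s = |x|^2, this is the factor |x|^-1 g(|x|^(-eps)) of x in the field. The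
    square is used because |x|^2 is a polynomial. *)
Definition profile s := s `^ (- (1 / 2)) * g (s `^ (- (eps / 2))).

Definition dprofile s :=
  s `^ (- (1 / 2)) * (g' (s `^ (- (eps / 2))) * (- (eps / 2) * s `^ (- (eps / 2) - 1))) +
  g (s `^ (- (eps / 2))) * (- (1 / 2) * s `^ (- (1 / 2) - 1)).

Lemma is_derive_profile s : 0 < s -> is_derive s (1 : R) profile (dprofile s : R^o).
Proof.
move=> s0.
have d1 := is_derive1_powR (- (1 / 2)) s0.
have d2 := is_derive1_powR (- (eps / 2)) s0.
have d3 := is_derive1_comp (g := fun s : R => s `^ (- (eps / 2)))
  (dg (s `^ (- (eps / 2)))) d2.
exact: (is_deriveM d1 d3).
Qed.

Lemma ndiff_on_profile m : ndiff_on [set s | 0 < s] m profile.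
Proof.
apply: ndiff_onM; first exact: ndiff_on_powR.
by apply: (ndiff_on_comp (V := setT)) => //; exact: ndiff_on_powR.
Qed.

(** Zero for s <= 1/c and for s >= c. The factor e normalizes the second bump, whose
    value tends to exp(-1), so that the cutoff tends to 1 as c grows. *)
Definition cutoff c s := flat 0 (c * s - 1) * flat 0 (1 - c^-1 * s) * expR 1.

Definition cut_profile c s :=
  flat 0 (c * s - 1) * (flat 0 (1 - c^-1 * s) * (expR 1 * profile s)).

Definition dcut_profile c s :=
  flat 0 (c * s - 1) * (flat 0 (1 - c^-1 * s) * (expR 1 * dprofile s) +
    expR 1 * profile s * (flat 2 (1 - c^-1 * s) * (- c^-1))) +
  c * flat 2 (c * s - 1) * (flat 0 (1 - c^-1 * s) * (expR 1 * profile s)).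

Lemma cut_profileE c s : cut_profile c s = cutoff c s * profile s.
Proof. by rewrite /cut_profile /cutoff; ring. Qed.

Lemma is_derive_cut_profile c s : 0 < c ->
  is_derive s (1 : R) (cut_profile c) (dcut_profile c s : R^o).
Proof.
move=> c0.
apply: is_derive_eq.
  apply: (is_derive_flat_mul 0 (w := fun s => flat 0 (1 - c^-1 * s) * (expR 1 * profile s))
   (w' := fun s => flat 0 (1 - c^-1 * s) * (expR 1 * dprofile s) +
      expR 1 * profile s * (flat 2 (1 - c^-1 * s) * (- c^-1))) c0) => s0.
  have dp := is_derive_profile s0.
  have dq : is_derive s (1 : R) (fun s : R => expR 1 * profile s)
      (expR 1 * dprofile s : R^o).
    apply: (is_derive_eq (is_deriveM (is_derive_cst (expR 1 : R^o) s (1 : R)) dp)).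
    by rewrite scaler0 addr0.
  have da : is_derive s (1 : R) (fun s : R => 1 - c^-1 * s) (- c^-1 : R^o).
    apply: is_derive_eq.
    by rewrite add0r mul1r [c^-1 *: _]mulr1.
  have db := is_derive1_comp (g := fun s : R => 1 - c^-1 * s)
    (is_derive_flat 0 (1 - c^-1 * s)) da.
  apply: (is_derive_eq (is_deriveM db dq)).
  by rewrite /GRing.scale/= mul0r subr0.
by rewrite /dcut_profile mul0r subr0.
Qed.

Lemma ndiff_on_cut_profile m c : 0 < c -> ndiff_on setT m (cut_profile c).
Proof.
move=> c0; apply: ndiff_on_flat_mul => //; apply: ndiff_onM.
  apply: (ndiff_on_comp (V := setT) (g := fun s => 1 - c^-1 * s)) => //.
    exact: ndiff_on_flat.
  have := ndiff_on_affine [set s | 0 < s] m (- c^-1) 1.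
  by congr ndiff_on; apply/funext => s; rewrite mulNr addrC.
by apply: ndiff_onM; [exact: ndiff_on_cst|exact: ndiff_on_profile].
Qed.

Lemma cut_profile0 c s : 0 < c -> c <= s -> cut_profile c s = 0.
Proof.
move=> c0 cs; rewrite /cut_profile (@flat_le0 _ 0 (1 - _)) ?mul0r ?mulr0//.
by rewrite subr_le0 -ler_pdivrMl ?invr_gt0// invrK mulr1.
Qed.

(** Twice s times the derivative of the cutoff. *)
Definition cutoff_error c s := 2 * expR 1 *
  (c * s * flat 2 (c * s - 1) * flat 0 (1 - c^-1 * s) -
   flat 0 (c * s - 1) * (c^-1 * s * flat 2 (1 - c^-1 * s))).

Lemma dcut_profileE c s : 2 * s * dcut_profile c s =
  cutoff c s * (2 * s * dprofile s) + cutoff_error c s * profile s.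
Proof. by rewrite /dcut_profile /cutoff /cutoff_error; ring. Qed.

Lemma flat0_le1 t : flat 0 t <= 1.
Proof.
rewrite /flat; case: ifPn => // t0.
by rewrite expr0 mul1r -[leRHS]expR0 ler_expR oppr_le0 invr_ge0 ltW.
Qed.

Lemma cutoff_le c s : `|cutoff c s| <= expR 1.
Proof.
rewrite /cutoff normrM (ger0_norm (expR_ge0 _)) -[leRHS]mul1r ler_wpM2r ?expR_ge0//.
rewrite ger0_norm ?mulr_ge0 ?flat_ge0// -[leRHS]mulr1.
by rewrite ler_pM ?flat_ge0 ?flat0_le1.
Qed.

(** With u = c s - 1 and v = 1 - s / c one has c s = u + 1 and s / c = 1 - v, and
    u or v is absorbed by [flatS]: the bound does not depend on c. *)
Lemma cutoff_error_le : exists2 C : R, 0 <= C & forall c s, `|cutoff_error c s| <= C.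
Proof.
have [C1 C10 hC1] := @flat_le R 1; have [C2 C20 hC2] := @flat_le R 2.
exists (2 * expR 1 * (2 * (C1 + C2))).
  by rewrite !mulr_ge0 ?expR_ge0 ?addr_ge0 ?ltW.
move=> c s; rewrite /cutoff_error normrM (ger0_norm (mulr_ge0 _ (expR_ge0 _)))//.
apply: ler_wpM2l; first by rewrite mulr_ge0 ?expR_ge0.
set u := c * s - 1; set v := 1 - c^-1 * s.
have -> : c * s * flat 2 u = flat 1 u + flat 2 u.
  by rewrite (flatS 1) /u; ring.
have -> : c^-1 * s * flat 2 v = flat 2 v - flat 1 v.
  by rewrite (flatS 1) /v; ring.
have F (j : nat) (t : R) : 0 <= flat j t by exact: flat_ge0.
have b1 : 0 <= (flat 1 u + flat 2 u) * flat 0 v <= C1 + C2.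
  rewrite mulr_ge0 ?addr_ge0//= -[leRHS]mulr1 ler_pM ?addr_ge0 ?flat0_le1//.
  exact: lerD.
have b2 : `|flat 0 u * (flat 2 v - flat 1 v)| <= C1 + C2.
  rewrite normrM (ger0_norm (F _ _)) -[leRHS]mul1r ler_pM ?flat0_le1//.
  rewrite (le_trans (ler_normB _ _))// !ger0_norm// addrC; exact: lerD.
rewrite (le_trans (ler_normB _ _))// [leRHS]mulr_natl mulr2n lerD//.
by case/andP: b1 => b10 b11; rewrite ger0_norm.
Qed.

Lemma cvg_flat0 (u : nat -> R) : u @ \oo --> +oo -> flat 0 (u k) @[k --> \oo] --> (1 : R).
Proof.
move=> uy.
have u0 : \forall k \near \oo, 0 < u k by move/cvgryPgt : uy; apply.
have -> : (1 : R) = expR (- 0) by rewrite oppr0 expR0.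
have uv : (fun k => expR (- (u k)^-1)) @ \oo --> expR (- 0 : R).
  apply: continuous_cvg; first exact: continuous_expR.
  by apply: cvgN; apply/gtr0_cvgV0.
apply: cvg_trans uv; apply: near_eq_cvg.
by near=> k; rewrite /flat ifT ?expr0 ?mul1r//; near: k.
Unshelve. all: by end_near. Qed.

Lemma cvg_flatS j (u : nat -> R) : u @ \oo --> +oo ->
  flat j.+1 (u k) @[k --> \oo] --> (0 : R).
Proof.
move=> uy; have [C C0 hC] := @flat_le R j.
have u0 : \forall k \near \oo, 0 < u k by move/cvgryPgt : uy; apply.
have Cu : (fun k => (u k)^-1 * C) @ \oo --> (0 : R).
  rewrite -(mul0r C); apply: cvgMl; exact/gtr0_cvgV0.
apply: (squeeze_cvgr _ (cvg_cst _) Cu); near=> k.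
have uk : 0 < u k by near: k.
rewrite flat_ge0/= ler_pdivlMl//.
by rewrite -flatS.
Unshelve. all: by end_near. Qed.

Let seqy s : 0 < s -> (fun k => k.+1%:R * s - 1) @ \oo --> +oo.
Proof.
move=> s0; apply/cvgryPgt => A; near=> k.
rewrite ltrBrDr -ltr_pdivrMr//; apply: (@lt_trans _ _ k%:R).
  by near: k; exact: nbhs_infty_gtr.
by rewrite ltr_nat.
Unshelve. all: by end_near. Qed.

Let seq0 s : (fun k => k.+1%:R^-1 * s) @ \oo --> (0 : R).
Proof.
rewrite -(mul0r s); apply: cvgMl; exact: cvg_harmonic.
Qed.

Lemma continuous_flat j : continuous (@flat R j).
Proof.
exact: (is_derive1_continuous (is_derive_flat j)).
Qed.

Lemma cvg_cutoff s : 0 < s -> cutoff k.+1%:R s @[k --> \oo] --> (1 : R).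
Proof.
move=> s0; have E : 1 * flat 0 (1 - 0) * expR 1 = 1 :> R.
  by rewrite subr0 mul1r /flat ltr01 expr0 mul1r invr1 -expRD addNr expR0.
rewrite -[X in _ --> X]E.
apply: cvgMl; apply: cvgM; first by apply: cvg_flat0; exact: seqy.
apply: continuous_cvg; first exact: continuous_flat.
by apply: cvgB; [exact: cvg_cst|exact: seq0].
Qed.

Lemma cvg_cutoff_error s : 0 < s -> cutoff_error k.+1%:R s @[k --> \oo] --> (0 : R).
Proof.
move=> s0; have E : 2 * expR 1 * ((0 + 0) * flat 0 (1 - 0) -
   1 * (0 * flat 2 (1 - 0))) = 0 :> R by ring.
rewrite -[X in _ --> X]E.
have cB j : flat j (1 - k.+1%:R^-1 * s) @[k --> \oo] --> flat j (1 - 0).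
  apply: continuous_cvg; first exact: continuous_flat.
  by apply: cvgB; [exact: cvg_cst|exact: seq0].
apply: cvgMr; apply: cvgB; apply: cvgM => //.
- rewrite (_ : (fun k => _) = (fun k => flat 1 (k.+1%:R * s - 1) + flat 2 (k.+1%:R * s - 1))).
    by apply: cvgD; apply: cvg_flatS; exact: seqy.
  by apply/funext => k; rewrite (flatS 1); ring.
- by apply: cvg_flat0; exact: seqy.
- by apply: cvgM => //; exact: seq0.
Qed.

End profile.

(** * Integration by parts *)

Section by_parts.
Context {R : realType} {n : nat}.
Local Notation mu := (@lebesgue_rV R n).

Lemma integral_by_parts (i : 'I_n) (psi psi' phi phi' : 'rV[R]_n -> R) (r : R) :
  (forall x, is_derive x (delta_mx ord0 i) psi (psi' x : R^o)) ->
  (forall x, is_derive x (delta_mx ord0 i) phi (phi' x : R^o)) ->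
  continuous psi -> continuous psi' -> continuous phi -> continuous phi' ->
  vanishes_outside r psi ->
  (\int[mu]_x (psi x * phi' x)%:E = - \int[mu]_x (psi' x * phi x)%:E)%E.
Proof.
move=> dpsi dphi cpsi cpsi' cphi cphi' psir.
have psi'r := partial_vanishes_outside psir dpsi.
have i1 : mu.-integrable setT (EFin \o (fun x => psi x * phi' x)).
  apply: (integrable_continuous_support (r := r)).
    by move=> x; apply: continuousM; [exact: cpsi|exact: cphi'].
  by move=> x /psir ->; rewrite mul0r.
have i2 : mu.-integrable setT (EFin \o (fun x => psi' x * phi x)).
  apply: (integrable_continuous_support (r := r + 1)).
    by move=> x; apply: continuousM; [exact: cpsi'|exact: cphi].
  by move=> x /psi'r ->; rewrite mul0r.
have E : (\int[mu]_x (psi x * phi' x + phi x * psi' x)%:E = 0)%E.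
  apply: (integral_partial0 (i := i) (g := fun x => psi x * phi x)
    (g' := fun x : 'rV[R]_n => psi x * phi' x + phi x * psi' x) (r := r)).
  - by move=> x; exact: (continuousD (continuousM (cpsi x) (cphi' x))
                                      (continuousM (cphi x) (cpsi' x))).
  - by move=> x /psir ->; rewrite mul0r.
have : (\int[mu]_x (psi x * phi' x)%:E + \int[mu]_x (psi' x * phi x)%:E = 0)%E.
  rewrite -(integralD_EFin measurableT i1 i2) -[RHS]E.
  by apply: eq_integral => x _; rewrite /= [phi x * _]mulrC.
have f1 := integrable_fin_num measurableT i1.
have f2 := integrable_fin_num measurableT i2.
move: f1 f2; rewrite /comp/=.
by move=> f1 f2 /eqP; rewrite -(fineK f1) -(fineK f2) -EFinD eqe addr_eq0 => /eqP ->.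
Qed.

Lemma Ck_sqr_enorm m : Ck m (fun x : 'rV[R]_n => enorm x ^+ 2).
Proof.
under eq_fun do rewrite sqr_enorm.
apply: Ck_sum => i; under eq_fun do rewrite expr2.
by apply: CkM; exact: Ck_coord.
Qed.

Lemma is_derive_sqr_enorm (i : 'I_n) (x : 'rV[R]_n) :
  is_derive x (delta_mx ord0 i) (fun y : 'rV[R]_n => enorm y ^+ 2)
    (2 * x ord0 i : R^o).
Proof.
under eq_fun do rewrite sqr_enorm.
have d (j : 'I_n) : is_derive x (delta_mx ord0 i)
    (fun y : 'rV[R]_n => y ord0 j ^+ 2) (2 * x ord0 j * (i == j)%:R : R^o).
  have dc := is_derive_coord j x (delta_mx ord0 i).
  apply: (is_derive_eq (is_deriveM dc dc)).
  by rewrite mxE eqxx/= eq_sym /GRing.scale/=; ring.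
have := is_derive_sum d; rewrite fct_sumE => ds; apply: (is_derive_eq ds).
rewrite (bigD1 i)//= eqxx mulr1 big1 ?addr0// => j ji.
by rewrite eq_sym (negbTE ji) mulr0.
Qed.

End by_parts.

(** * Truncated radial fields *)

Section radial_field.
Context {R : realType} {n : nat}.
Variables (eps : R) (g g' : R -> R) (M : R).
Hypothesis eps_gt0 : 0 < eps.
Hypothesis Dg : forall m, ndiff_on setT m g.
Hypothesis dg : forall s, is_derive s (1 : R) g (g' s : R^o).
Hypothesis gM : forall s, `|g s| <= M.
Hypothesis g'M : forall s, `|g' s| <= M.
Implicit Types (x : 'rV[R]_n) (c t : R) (k : nat).
Local Notation mu := (@lebesgue_rV R n).

(** At the origin both powers are 0 by convention, hence so is this function; it
    is there the limit of the divergences of the truncated fields, which vanish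
    near 0. *)
Definition radial_div x :=
  - eps * enorm x `^ (- 1 - eps) * g' (enorm x `^ (- eps)) +
  (n%:R - 1) * (enorm x)^-1 * g (enorm x `^ (- eps)).

(** The common majorant of the divergences of the truncated fields. *)
Definition weight x : R := enorm x `^ (- 1 - eps) + (enorm x)^-1.

Definition cut_field c (i : 'I_n) x := x ord0 i * cut_profile eps g c (enorm x ^+ 2).

Definition dcut_field c (i : 'I_n) x := cut_profile eps g c (enorm x ^+ 2) +
  x ord0 i * (dcut_profile eps g g' c (enorm x ^+ 2) * (2 * x ord0 i)).

Lemma is_derive_cut_field c i x : 0 < c ->
  is_derive x (delta_mx ord0 i) (cut_field c i) (dcut_field c i x : R^o).
Proof.
move=> c0; have d1 := is_derive_coord i x (delta_mx ord0 i).
have d2 := is_derive_comp_line (is_derive_cut_profile eps dg (enorm x ^+ 2) c0)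
  (is_derive_sqr_enorm i x).
apply: (is_derive_eq (is_deriveM d1 d2)).
by rewrite mxE !eqxx /dcut_field /GRing.scale/=; ring.
Qed.

Lemma Ck_cut_field c i m : 0 < c -> Ck m (cut_field c i).
Proof.
move=> c0; apply: CkM; first exact: Ck_coord.
apply: (Ck_comp (h := cut_profile eps g c)); last exact: Ck_sqr_enorm.
exact: ndiff_on_cut_profile.
Qed.

Lemma smooth_cut_field c i : 0 < c -> smooth (cut_field c i).
Proof. by move=> c0; apply: Ck_smooth => m; exact: Ck_cut_field. Qed.

Lemma partial_cut_field c i : 0 < c -> partial i (cut_field c i) = dcut_field c i.
Proof.
by move=> c0; apply/funext => x; have [] := is_derive_cut_field i x c0.
Qed.

Lemma continuous_dcut_field c i : 0 < c -> continuous (dcut_field c i).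
Proof.
move=> c0; rewrite -partial_cut_field//; apply: smooth_continuous_partial.
exact: smooth_cut_field.
Qed.

Lemma cut_field_vanishes c i : 1 <= c -> vanishes_outside c (cut_field c i).
Proof.
move=> c1 x cx; have c0 : 0 < c by exact: lt_le_trans c1.
rewrite /cut_field cut_profile0 ?mulr0// (le_trans cx)// expr2 ler_peMr ?enorm_ge0//.
exact: le_trans cx.
Qed.

Lemma test_cut_field c i : 1 <= c -> test_function (cut_field c i).
Proof.
move=> c1; split; first by apply: smooth_cut_field; exact: lt_le_trans c1.
exact: (vanishes_compact_support (cut_field_vanishes i c1)).
Qed.

Lemma sum_dcut_field c x : \sum_(i < n) dcut_field c i x =
  n%:R * cut_profile eps g c (enorm x ^+ 2) +
  2 * enorm x ^+ 2 * dcut_profile eps g g' c (enorm x ^+ 2).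
Proof.
rewrite big_split/= sumr_const card_ord mulr_natl; congr (_ + _).
rewrite {2}sqr_enorm mulr_sumr mulr_suml; apply: eq_bigr => i _.
by ring.
Qed.

Lemma powR_sqr t (p : R) : 0 < t -> (t ^+ 2) `^ p = t `^ (2 * p).
Proof.
move=> t0; rewrite !powR_expR ?exprn_gt0// lnXn//; congr expR.
by rewrite mulr2n; ring.
Qed.

Lemma profile_sqr t : 0 < t -> profile eps g (t ^+ 2) = t^-1 * g (t `^ (- eps)).
Proof.
move=> t0; rewrite /profile !powR_sqr//.
have -> : 2 * (- (eps / 2)) = - eps by field.
have -> : 2 * (- (1 / 2)) = - 1 :> R by field.
by rewrite powR_inv1// ltW.
Qed.

Lemma dprofile_sqr t : 0 < t -> 2 * t ^+ 2 * dprofile eps g g' (t ^+ 2) =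
  - eps * t `^ (- 1 - eps) * g' (t `^ (- eps)) - t^-1 * g (t `^ (- eps)).
Proof.
move=> t0; rewrite /dprofile !powR_sqr//.
have -> : 2 * (- (eps / 2)) = - eps by field.
have -> : 2 * (- (1 / 2)) = - 1 :> R by field.
have -> : 2 * (- (1 / 2) - 1) = - 1 + - 1 + - 1:> R by field.
have -> : 2 * (- (eps / 2) - 1) = - eps + - 1 + - 1 by field.
have E (a b : R) : t `^ (a + b) = t `^ a * t `^ b.
  by rewrite !powR_expR// mulrDl expRD.
rewrite !E powR_inv1 ?ltW//; field.
by rewrite gt_eqF.
Qed.

(** The divergence of chi F is chi div F plus the radial derivative of chi times
    the radial component of F. *)
Lemma sum_dcut_fieldE c x : 0 < enorm x -> \sum_(i < n) dcut_field c i x =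
  cutoff c (enorm x ^+ 2) * radial_div x +
  cutoff_error c (enorm x ^+ 2) * ((enorm x)^-1 * g (enorm x `^ (- eps))).
Proof.
move=> x0; rewrite sum_dcut_field dcut_profileE cut_profileE.
rewrite profile_sqr// dprofile_sqr// /radial_div.
by ring.
Qed.

Lemma radial_div_le x : 0 < enorm x -> (0 < n)%N ->
  `|radial_div x| <= (eps + n%:R) * M * weight x.
Proof.
move=> x0 n0; have M0 : 0 <= M by exact: le_trans (gM 0).
have n1 : 1 <= n%:R :> R by rewrite ler1n.
have a0 : 0 <= enorm x `^ (- 1 - eps) by exact: powR_ge0.
have b0 : 0 <= (enorm x)^-1 by rewrite invr_ge0 enorm_ge0.
have e1 : `|- eps * enorm x `^ (- 1 - eps) * g' (enorm x `^ (- eps))| <=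
    (eps + n%:R) * enorm x `^ (- 1 - eps) * M.
  rewrite normrM ler_pM// mulNr normrN normrM (ger0_norm a0) gtr0_norm//.
  by rewrite ler_wpM2r// lerDl.
have e2 : `|(n%:R - 1) * (enorm x)^-1 * g (enorm x `^ (- eps))| <=
    (eps + n%:R) * (enorm x)^-1 * M.
  rewrite normrM ler_pM// normrM (ger0_norm b0) ger0_norm ?subr_ge0//.
  by apply: ler_wpM2r => //; apply: (@le_trans _ _ n%:R); rewrite ?gerBl ?lerDr ?ltW.
rewrite (le_trans (ler_normD _ _))// (le_trans (lerD e1 e2))// /weight.
by rewrite le_eqVlt; apply/orP; left; apply/eqP; ring.
Qed.

Lemma radial_div0 x : enorm x = 0 -> radial_div x = 0.
Proof.
move=> x0; rewrite /radial_div x0 invr0 powR0; first by rewrite !(mulr0, mul0r) addr0.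
by rewrite lt_eqF// -opprD oppr_lt0 ltr_wpDl.
Qed.

Lemma sum_dcut_field0 c x : enorm x = 0 -> \sum_(i < n) dcut_field c i x = 0.
Proof.
move=> x0; rewrite sum_dcut_field x0 expr0n/= !(mulr0, mul0r) addr0 /cut_profile.
by rewrite mulr0 flat_le0 ?mul0r ?mulr0// sub0r lerN10.
Qed.

Lemma sum_dcut_field_le : (0 < n)%N -> exists2 C : R, 0 <= C & forall c x,
  `|\sum_(i < n) dcut_field c i x| <= C * weight x.
Proof.
move=> n0; have [C C0 hC] := @cutoff_error_le R.
have M0 : 0 <= M by exact: le_trans (gM 0).
exists (expR 1 * ((eps + n%:R) * M) + C * M).
  by rewrite addr_ge0 ?mulr_ge0 ?expR_ge0 ?addr_ge0// ltW.
move=> c x.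
have w0 : 0 <= weight x by rewrite addr_ge0 ?powR_ge0 ?invr_ge0 ?enorm_ge0.
have [x0|x0] := eqVneq (enorm x) 0.
  rewrite sum_dcut_field0// normr0 mulr_ge0// addr_ge0 ?mulr_ge0 ?expR_ge0 ?addr_ge0//.
  exact: ltW.
have {}x0 : 0 < enorm x by rewrite lt_neqAle eq_sym x0 enorm_ge0.
rewrite sum_dcut_fieldE// (le_trans (ler_normD _ _))// mulrDl lerD//.
  rewrite normrM -[leRHS]mulrA ler_pM ?cutoff_le//.
  exact: radial_div_le.
rewrite normrM -mulrA ler_pM//.
rewrite normrM mulrC ler_pM// ger0_norm ?invr_ge0 ?enorm_ge0// lerDr.
exact: powR_ge0.
Qed.

Lemma cvg_sum_dcut_field x :
  \sum_(i < n) dcut_field k.+1%:R i x @[k --> \oo] --> radial_div x.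
Proof.
have [x0|x0] := eqVneq (enorm x) 0.
  rewrite radial_div0//; under eq_fun do rewrite sum_dcut_field0//.
  exact: cvg_cst.
have {}x0 : 0 < enorm x by rewrite lt_neqAle eq_sym x0 enorm_ge0.
under eq_fun do rewrite sum_dcut_fieldE//.
set b := _ * g _; have x20 : 0 < enorm x ^+ 2 by rewrite exprn_gt0.
have := cvgD (cvgMl (b := radial_div x) (cvg_cutoff x20))
  (cvgMl (b := b) (cvg_cutoff_error x20)).
by rewrite mul1r mul0r addr0; exact.
Qed.

Lemma cut_field_le c i x : `|cut_field c i x| <= expR 1 * M.
Proof.
have M0 : 0 <= M by exact: le_trans (gM 0).
have [x0|x0] := eqVneq (enorm x) 0.
  have /eqP := x0; rewrite enorm_eq0 => /eqP ->.
  by rewrite /cut_field mxE mul0r normr0 mulr_ge0 ?expR_ge0.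
have {}x0 : 0 < enorm x by rewrite lt_neqAle eq_sym x0 enorm_ge0.
rewrite /cut_field cut_profileE profile_sqr// mulrCA normrM ler_pM ?cutoff_le//.
rewrite mulrA normrM -[leRHS]mul1r ler_pM//.
by rewrite normrM normfV (ger0_norm (enorm_ge0 _)) ler_pdivrMr// mul1r coord_le_enorm.
Qed.

Lemma radial_field_le i x :
  `|(enorm x)^-1 * g (enorm x `^ (- eps)) * x ord0 i| <= M.
Proof.
have M0 : 0 <= M by exact: le_trans (gM 0).
rewrite -mulrA mulrCA normrM -[leRHS]mulr1 ler_pM//.
have [->|x0] := eqVneq x 0; first by rewrite mxE mulr0 normr0.
rewrite normrM normfV (ger0_norm (enorm_ge0 _)) ler_pdivrMl ?mulr1 ?coord_le_enorm//.
by rewrite lt_neqAle eq_sym enorm_eq0 x0 enorm_ge0.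
Qed.

Lemma cvg_cut_field i x : cut_field k.+1%:R i x @[k --> \oo] -->
  (enorm x)^-1 * g (enorm x `^ (- eps)) * x ord0 i.
Proof.
have [x0|x0] := eqVneq (enorm x) 0.
  have /eqP := x0; rewrite enorm_eq0 => /eqP ->.
  rewrite !mxE mulr0; under eq_fun do rewrite /cut_field mxE mul0r.
  exact: cvg_cst.
have {}x0 : 0 < enorm x by rewrite lt_neqAle eq_sym x0 enorm_ge0.
under eq_fun do rewrite /cut_field cut_profileE profile_sqr// mulrCA.
rewrite [X in nbhs X]mulrC; set b := x ord0 i * _.
have x20 : 0 < enorm x ^+ 2 by rewrite exprn_gt0.
by have := cvgMl (b := b) (cvg_cutoff x20); rewrite mul1r; exact.
Qed.

Lemma measurable_inv_enorm : measurable_fun setT (fun x => (enorm x)^-1).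
Proof.
under eq_fun do rewrite -powR_inv1 ?enorm_ge0//.
exact: measurable_enorm_powR.
Qed.

Lemma measurable_radial_field i : measurable_fun setT (fun x =>
  (enorm x)^-1 * g (enorm x `^ (- eps)) * x ord0 i).
Proof.
apply: measurable_funM; last exact: measurable_coord.
apply: measurable_funM; first exact: measurable_inv_enorm.
apply: (measurableT_comp _ (measurable_enorm_powR (- eps))).
apply: continuous_measurable_fun; exact: is_derive1_continuous dg.
Qed.

Lemma measurable_radial_div : measurable_fun setT g' -> measurable_fun setT radial_div.
Proof.
move=> mg'; have mg : measurable_fun setT g.
  by apply: continuous_measurable_fun; exact: is_derive1_continuous dg.
have mt := @measurable_enorm_powR R n (- eps).
apply: measurable_funD; apply: measurable_funM.
- by apply: measurable_funM => //; exact: measurable_enorm_powR.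
- exact: (measurableT_comp mg' mt).
- by apply: measurable_funM => //; exact: measurable_inv_enorm.
- exact: (measurableT_comp mg mt).
Qed.

End radial_field.

(** * Divergence of the radial field *)

Lemma dim_gt0 (R : realType) (n : nat) (eps : R) :
  0 < eps -> eps < n%:R - 1 -> (0 < n)%N.
Proof.
move=> eps0 epsn; rewrite lt0n; apply/eqP => n0; move: (lt_trans eps0 epsn).
by rewrite n0 sub0r oppr_gt0 ltr10.
Qed.

Section weighted_integrals.
Context {R : realType} {n : nat}.
Local Notation mu := (@lebesgue_rV R n).
Implicit Types (u : 'rV[R]_n -> R).

Lemma integrable_powR_support (a : R) u (C r : R) : 0 < a -> a < n%:R ->
  measurable_fun setT u -> (forall x, `|u x| <= C) -> vanishes_outside r u ->
  mu.-integrable setT (EFin \o (fun x => u x * enorm x `^ (- a))).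
Proof.
move=> a0 an mU uC ur.
have C0 : 0 <= C by exact: le_trans (uC 0).
have r0 : 0 < `|r| + 1 by rewrite ltr_wpDl.
have mw : measurable_fun setT (fun x : 'rV[R]_n => enorm x `^ (- a)).
  exact: measurable_enorm_powR.
apply/integrableP; split.
  by apply/measurable_EFinP; exact: measurable_funM.
have [D D0 hD] := integral_powR_eball a0 an.
apply: (@le_lt_trans _ _
  (\int[mu]_(x in eball (`|r| + 1)) (C%:E * (enorm x `^ (- a))%:E))%E).
  rewrite [leRHS]integral_mkcond; apply: ge0_le_integral => //.
  - apply: measurableT_comp => //.
    by apply/measurable_EFinP; exact: measurable_funM.
  - apply/(measurable_restrictT _ (measurable_eball _)).
    apply: measurable_funTS; apply/measurable_EFinP.
    exact: measurable_funM.
  move=> x _ /=; rewrite patchE; case: ifPn => [_|].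
    rewrite -EFinM lee_fin normrM (ger0_norm (powR_ge0 _ _)).
    by rewrite ler_wpM2r ?powR_ge0.
  rewrite notin_setE /eball/= => /negP; rewrite -leNgt => rx.
  by rewrite ur ?mul0r ?normr0// (le_trans _ rx)// (le_trans (ler_norm _))// lerDl.
rewrite ge0_integralZl ?lee_fin//.
- by rewrite (le_lt_trans (lee_wpmul2l _ (hD _ r0)))// -EFinM ltry.
- exact: measurable_eball.
- by apply/measurable_EFinP; apply: measurable_funTS.
- by move=> x _; rewrite lee_fin powR_ge0.
Qed.

Lemma integrable_weight_support (eps : R) u (C r : R) : 0 < eps -> eps < n%:R - 1 ->
  measurable_fun setT u -> (forall x, `|u x| <= C) -> vanishes_outside r u ->
  mu.-integrable setT (EFin \o (fun x => u x * weight eps x)).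
Proof.
move=> e0 en mU uC ur.
have := integrableD measurableT
  (@integrable_powR_support (1 + eps) u C r (ltr_pwDr e0 ler01) _ mU uC ur)
  (@integrable_powR_support 1 u C r ltr01 _ mU uC ur).
rewrite -ltrBrDl => /(_ en); rewrite -subr_gt0 (lt_trans e0 en) => /(_ isT).
apply: eq_integrable => // x _ /=.
by rewrite -EFinD -mulrDr opprD powR_inv1 ?enorm_ge0.
Qed.

Lemma integrable_mul_bounded u (w : 'rV[R]_n -> R) (D : R) :
  mu.-integrable setT (EFin \o u) -> measurable_fun setT w ->
  (forall x, `|w x| <= D) ->
  mu.-integrable setT (fun x => (u x * w x)%:E).
Proof.
move=> iu mw wD.
apply: (@le_integrable _ _ _ _ _ _ _ (fun x => D%:E * (u x)%:E)%E) => //.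
- apply/measurable_EFinP; apply: measurable_funM => //.
  by apply/measurable_EFinP; exact: measurable_int iu.
- move=> x _; rewrite -EFinM !abse_EFin lee_fin !normrM mulrC.
  by rewrite ler_wpM2r// (le_trans (wD x))// ler_norm.
- exact: integrableZl.
Qed.

End weighted_integrals.

Section radial_limits.
Context {R : realType} {n : nat}.
Variables (eps : R) (g g' : R -> R) (M : R).
Hypothesis eps_gt0 : 0 < eps.
Hypothesis eps_ltn : eps < n%:R - 1.
Hypothesis Dg : forall m, ndiff_on setT m g.
Hypothesis dg : forall s, is_derive s (1 : R) g (g' s : R^o).
Hypothesis gM : forall s, `|g s| <= M.
Hypothesis g'M : forall s, `|g' s| <= M.
Local Notation mu := (@lebesgue_rV R n).
Local Notation F := (@cut_field R n eps g).
Local Notation dF := (@dcut_field R n eps g g').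
Local Notation divF := (@radial_div R n eps g g').

Let n_gt0 : (0 < n)%N. Proof. exact: dim_gt0 eps_ltn. Qed.

Let M0 : 0 <= M. Proof. exact: le_trans (gM 0). Qed.

(** Dominated convergence, the dominating function being u times [weight]. *)
Lemma cvg_integral_sum_dcut_field (u : 'rV[R]_n -> R) (C r : R) :
  measurable_fun setT u -> (forall x, `|u x| <= C) -> vanishes_outside r u ->
  (\int[mu]_x (u x * \sum_(i < n) dF k.+1%:R i x)%:E)%E @[k --> \oo] -->
  (\int[mu]_x (u x * divF x)%:E)%E.
Proof.
move=> mU uC ur.
have [D D0 hD] := sum_dcut_field_le (eps := eps) eps_gt0 gM g'M n_gt0.
apply: (dominated_cvg measurableT
  (f_ := fun k x => (u x * \sum_(i < n) dF k.+1%:R i x)%:E)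
  (g := fun x => (D%:E * (`|u x| * weight eps x)%:E)%E)).
- move=> k; apply/measurable_EFinP; apply: measurable_funM => //.
  apply: measurable_sum => i.
  by apply: continuous_measurable_rV; exact: continuous_dcut_field.
- by move=> x _; apply: cvg_EFin; [apply: nearW|apply: cvgMr; exact: cvg_sum_dcut_field].
- by [].
- apply: integrableZl => //; apply: (integrable_weight_support (C := C) (r := r)) => //.
  + exact: measurableT_comp.
  + by move=> x; rewrite normr_id.
  + by move=> x /ur ->; rewrite normr0.
- move=> k x _; rewrite abse_EFin -EFinM lee_fin normrM mulrCA.
  by rewrite ler_wpM2l.
Qed.

Lemma integral_sum_dcut_field (u : 'rV[R]_n -> R) (k : nat) :
  mu.-integrable setT (EFin \o u) ->
  (\int[mu]_x (u x * \sum_(i < n) dF k.+1%:R i x)%:E =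
   \sum_(i < n) \int[mu]_x (u x * partial i (F k.+1%:R i) x)%:E)%E.
Proof.
move=> iu; rewrite -integral_sum//.
  apply: eq_integral => x _; rewrite mulr_sumr -sumEFin.
  by apply: eq_bigr => i _; rewrite partial_cut_field.
move=> i; rewrite partial_cut_field//.
have k1 : 1 <= k.+1%:R :> R by rewrite ler1n.
have cdF : continuous (dF k.+1%:R i) by exact: continuous_dcut_field.
have Fr : vanishes_outside k.+1%:R (F k.+1%:R i) by exact: cut_field_vanishes.
have dFr : vanishes_outside (k.+1%:R + 1) (dF k.+1%:R i).
  apply: (partial_vanishes_outside Fr (v := delta_mx ord0 i)) => x.
  exact: is_derive_cut_field.
have [D D0 hD] := vanishes_outside_bounded dFr cdF.
exact: (integrable_mul_bounded iu (continuous_measurable_rV cdF) hD).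
Qed.

(** The identity for the truncated fields is an integration by parts; it passes
    to the limit on both sides because the fields are bounded, and their
    divergences dominated, uniformly. *)
Theorem radial_divergence (phi : 'rV[R]_n -> R) : test_function phi ->
  (\int[mu]_x (divF x * phi x)%:E =
   - \int[mu]_x (\sum_(i < n) (enorm x)^-1 * g (enorm x `^ (- eps)) * x ord0 i
                   * partial i phi x)%:E)%E.
Proof.
move=> [sphi cphi]; have [r r0 phir] := compact_support_vanishes cphi.
have ctphi := smooth_continuous sphi.
have [C C0 hC] := vanishes_outside_bounded phir ctphi.
have cpart i : continuous (partial i phi) by exact: smooth_continuous_partial.
have dphi i : forall x, is_derive x (delta_mx ord0 i) phi (partial i phi x : R^o).
  exact: smooth_is_derive.
have pr i := partial_vanishes_outside phir (dphi i).
have ipart i : mu.-integrable setT (EFin \o partial i phi).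
  exact: (integrable_continuous_support (cpart i) (pr i)).
have iphi := integrable_continuous_support ctphi phir.
have L1 := cvg_integral_sum_dcut_field (continuous_measurable_rV ctphi) hC phir.
have L2 : (\int[mu]_x (\sum_(i < n) F k.+1%:R i x * partial i phi x)%:E)%E
    @[k --> \oo] -->
    (\int[mu]_x (\sum_(i < n) (enorm x)^-1 * g (enorm x `^ (- eps)) * x ord0 i
                   * partial i phi x)%:E)%E.
  apply: (dominated_cvg measurableT
    (f_ := fun k x => (\sum_(i < n) F k.+1%:R i x * partial i phi x)%:E)
    (g := fun x => (\sum_(i < n) (expR 1 * M)%:E * `|(partial i phi x)%:E|)%E)).
  - move=> k; apply/measurable_EFinP; apply: measurable_sum => i.
    apply: measurable_funM; apply: continuous_measurable_rV => //.
    by apply: smooth_continuous; exact: smooth_cut_field.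
  - move=> x _; apply: cvg_EFin; first exact: nearW.
    apply: cvg_big => [|i _]; first exact: add_continuous.
    by apply: cvgMl; exact: cvg_cut_field.
  - move=> x _; rewrite (eq_bigr (fun i => (expR 1 * M * `|partial i phi x|)%:E))//.
    by rewrite sumEFin.
  - apply: integrable_sum => // i _; apply: integrableZl => //.
    exact: (integrable_abse (ipart i)).
  - move=> k x _; rewrite (eq_bigr (fun i => (expR 1 * M * `|partial i phi x|)%:E))//.
    rewrite sumEFin abse_EFin lee_fin (le_trans (ler_norm_sum _ _ _))//.
    apply: ler_sum => i _; rewrite normrM ler_wpM2r//.
    exact: cut_field_le.
have E k : (\int[mu]_x (phi x * \sum_(i < n) dF k.+1%:R i x)%:E =
    - \int[mu]_x (\sum_(i < n) F k.+1%:R i x * partial i phi x)%:E)%E.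
  rewrite integral_sum_dcut_field//.
  have iF i : mu.-integrable setT (fun x => (F k.+1%:R i x * partial i phi x)%:E).
    apply: (integrable_continuous_support (r := r + 1)
      (g := fun x => F k.+1%:R i x * partial i phi x)).
      move=> x; apply: continuousM; last exact: cpart.
      by apply: smooth_continuous; exact: smooth_cut_field.
    by move=> x /pr ->; rewrite mulr0.
  under [in RHS]eq_integral do rewrite -sumEFin.
  rewrite integral_sum// -sumeN; last first.
    by move=> i j _ _; rewrite fin_num_adde_defl// integrable_fin_num.
  apply: eq_bigr => i _.
  have sF : smooth (F k.+1%:R i) by exact: smooth_cut_field.
  have dF x : is_derive x (delta_mx ord0 i) (F k.+1%:R i)
      (partial i (F k.+1%:R i) x : R^o) by exact: smooth_is_derive.
  rewrite (integral_by_parts (dphi i) dF _ _ _ _ phir)//.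
  - by congr (- _)%E; apply: eq_integral => x _; rewrite mulrC.
  - exact: smooth_continuous.
  - exact: smooth_continuous_partial.
under eq_integral do rewrite mulrC.
by move: L1; rewrite (funext E) => L1; apply: (cvg_unique _ L1 (cvgeN L2)).
Qed.

End radial_limits.

(** * The radial divergence in the dual of BV *)

Section charge_bounds.
Context {R : realType} {n : nat}.
Local Notation mu := (@lebesgue_rV R n).
Implicit Types (nu : 'I_n -> {charge set 'rV[R]_n -> \bar R}).

(** P, N, and then empty sets, form one of the partitions of the supremum. *)
Lemma normr_le_charge_variation nu (i : 'I_n) (P N : set 'rV[R]_n) :
  measurable P -> measurable N -> P `|` N = setT -> P `&` N = set0 ->
  (`|nu i P| + `|nu i N| <= vector_measure_variation nu)%E.
Proof.
move=> mP mN PN PN0.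
pose E (k : nat) : set 'rV[R]_n := if k is 0%N then P else if k is 1%N then N else set0.
apply: (@le_trans _ _ (\sum_(k <oo) (enorm (\row_i fine (nu i (E k))))%:E)%E).
  have h (A : set 'rV[R]_n) : measurable A ->
      (`|nu i A| <= (enorm (\row_i fine (nu i A)))%:E)%E.
    move=> mA; rewrite -(fineK (fin_num_measure (nu i) _ mA)) lee_fin.
    by have := coord_le_enorm (\row_i fine (nu i A)) i; rewrite mxE.
  apply: (@le_trans _ _ (\sum_(0 <= k < 2) (enorm (\row_i fine (nu i (E k))))%:E)%E).
    by rewrite !big_nat_recl//= big_geq// adde0 leeD// h.
  by apply: nneseries_lim_ge => k _ _; rewrite lee_fin enorm_ge0.
apply: ereal_sup_ubound; exists E => //; split.
- by move=> [|[|k]]//=; exact: measurable0.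
- apply/trivIsetP => -[|[|a]] [|[|b]]//= _ _ _; rewrite ?set0I ?setI0//.
  by rewrite setIC.
- apply/seteqP; split=> // x _; have : setT x by [].
  by rewrite -PN => -[Px|Nx]; [exists 0%N|exists 1%N].
Qed.

(** A bound component by component, through the Hahn decomposition of nu i. It
    costs a factor n in the duality constant, but no approximation of phi by
    simple functions. *)
Lemma charge_integral_le nu (i : 'I_n) (phi : 'rV[R]_n -> R) (C : R) :
  measurable_fun setT phi -> (forall x, `|phi x| <= C) ->
  (`|charge_integral (nu i) (EFin \o phi)| <=
   C%:E * vector_measure_variation nu)%E.
Proof.
move=> mphi phiC; rewrite /charge_integral.
set P := projT1 _; set N := projT1 _; set nuPN := projT2 _.
have [[mP posP] [mN negN] PN PN0] := nuPN.
have C0 : 0 <= C by exact: le_trans (phiC 0).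
have b (m : {finite_measure set 'rV[R]_n -> \bar R}) :
    (`|\int[m]_x (phi x)%:E| <= C%:E * m setT)%E.
  apply: (le_trans (le_abse_integral _ _ _)) => //; first exact/measurable_EFinP.
  rewrite -integral_cst//; apply: ge0_le_integral => //.
  - by apply: measurableT_comp => //; exact/measurable_EFinP.
  - by move=> x _; rewrite abse_EFin lee_fin.
apply: (le_trans (lee_abs_sub _ _)).
apply: (le_trans (leeD (b _) (b _))).
rewrite -muleDr ?ge0_adde_def ?inE//.
rewrite lee_wpmul2l ?lee_fin//.
apply: le_trans (normr_le_charge_variation nu i mP mN PN PN0).
apply: leeD.
  rewrite -[X in (X <= _)%E]/(jordan_pos nuPN setT).
  rewrite jordan_posE charge.cjordan_posE /crestr0 mem_set//= /crestr setTI.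
  by rewrite lee_abs.
rewrite -[X in (X <= _)%E]/(jordan_neg nuPN setT).
rewrite jordan_negE charge.cjordan_negE /crestr0 mem_set//= /crestr setTI.
by rewrite -abseN lee_abs.
Qed.

(** Truncating u on the null set where it exceeds its essential bounds changes no
    integral, and makes the bounds hold everywhere. *)
Lemma BVc_bounded_representative (u : 'rV[R]_n -> R) : in_BVc u ->
  exists v : 'rV[R]_n -> R, [/\ measurable_fun setT v,
    exists C, forall x, `|v x| <= C, exists r, vanishes_outside r v &
    forall w : 'rV[R]_n -> R, measurable_fun setT w ->
      (\int[mu]_x (u x * w x)%:E = \int[mu]_x (v x * w x)%:E)%E].
Proof.
move=> [[iu _] [M uM] [K cK uK]].
have mu_ : measurable_fun setT u by apply/measurable_EFinP; exact: measurable_int iu.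
have [r _ Kr] := compact_eball cK.
pose A : set 'rV[R]_n := [set x | `|u x| <= M] `&` K.
have mA : measurable A.
  apply: measurableI; last exact: compact_measurable_rV.
  rewrite -[X in measurable X]setTI.
  apply: (measurable_fun_le measurableT).
    exact: measurableT_comp.
  exact: measurable_cst.
pose v x := u x * \1_A x.
have mv : measurable_fun setT v.
  by apply: measurable_funM => //; exact: measurable_indic.
exists v; split => //.
- exists `|M| => x; rewrite /v indicE; case: (boolP (x \in A)) => [|_].
    by rewrite inE mulr1 => -[/= uxM _]; rewrite (le_trans uxM)// ler_norm.
  by rewrite mulr0 normr0.
- exists r => x rx; rewrite /v indicE memNset ?mulr0// => -[_ /Kr].
  by rewrite /eball/= ltNge rx.
move=> w mw; apply: ae_eq_integral => //.
- by apply/measurable_EFinP; exact: measurable_funM.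
- by apply/measurable_EFinP; exact: measurable_funM.
apply: filterS2 uM uK => x uxM uxK _; rewrite /v indicE.
have [Kx|nKx] := pselect (K x); first by rewrite mem_set ?mulr1.
by rewrite uxK// !mul0r.
Qed.

End charge_bounds.

Section radial_dual.
Context {R : realType} {n : nat}.
Variables (eps : R) (g g' : R -> R) (M : R).
Hypothesis eps_gt0 : 0 < eps.
Hypothesis eps_ltn : eps < n%:R - 1.
Hypothesis Dg : forall m, ndiff_on setT m g.
Hypothesis dg : forall s, is_derive s (1 : R) g (g' s : R^o).
Hypothesis mg' : measurable_fun setT g'.
Hypothesis gM : forall s, `|g s| <= M.
Hypothesis g'M : forall s, `|g' s| <= M.
Local Notation mu := (@lebesgue_rV R n).
Local Notation divF := (@radial_div R n eps g g').

Let n_gt0 : (0 < n)%N. Proof. exact: dim_gt0 eps_ltn. Qed.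

Lemma radial_div_le_weight x : `|divF x| <= (eps + n%:R) * M * weight eps x.
Proof.
have [x0|x0] := eqVneq (enorm x) 0.
  rewrite radial_div0// normr0 mulr_ge0 ?mulr_ge0 ?addr_ge0 ?powR_ge0//.
  - exact: ltW.
  - exact: le_trans (gM 0).
  - by rewrite invr_ge0 enorm_ge0.
apply: (radial_div_le eps_gt0 gM g'M) => //.
by rewrite lt_neqAle eq_sym x0 enorm_ge0.
Qed.

Lemma radial_div_locally_integrable : locally_integrable_rV divF.
Proof.
have mdiv : measurable_fun setT divF by exact: measurable_radial_div.
split=> // K cK; have mK := compact_measurable_rV cK.
have [r _ hr] := compact_eball cK.
have iw : mu.-integrable K (fun x => ((eps + n%:R) * M)%:E *
    (\1_(eball r) x * weight eps x)%:E)%E.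
  apply: integrableZl => //; apply: (integrableS measurableT) => //.
  apply: (@integrable_weight_support _ _ _ _ 1 r) => //.
  - by apply: measurable_indic; exact: measurable_eball.
  - by move=> x; rewrite indicE ger0_norm// lern1 leq_b1.
  - move=> x rx; rewrite indicE memNset// /eball/= => /lt_le_trans/(_ rx).
    by rewrite ltxx.
apply: (le_integrable mK _ _ iw).
  by apply/measurable_EFinP; exact: measurable_funTS.
move=> x Kx; rewrite -EFinM !abse_EFin lee_fin indicE mem_set; last exact: hr.
by rewrite mul1r (le_trans (radial_div_le_weight x))// ler_norm.
Qed.

Theorem radial_div_dual : in_BV_dual divF.
Proof.
split; first exact: radial_div_locally_integrable.
exists (n%:R * (expR 1 * M)) => u nu uBV Du.
have [v [mv [C vC] [r vr] uv]] := BVc_bounded_representative uBV.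
have mdiv : measurable_fun setT divF by exact: measurable_radial_div.
rewrite uv//.
have L := cvg_integral_sum_dcut_field eps_gt0 eps_ltn Dg dg gM g'M mv vC vr.
have iv : mu.-integrable setT (EFin \o v) by exact: integrable_bounded_support vr vC.
have L' := cvg_abse L.
have /(@cvg_lim _) <- // :
    `|\int[mu]_x (v x * \sum_(i < n) dcut_field eps g g' k.+1%:R i x)%:E|%E
    @[k --> \oo] --> `|\int[mu]_x (v x * divF x)%:E|%E by exact: cvg_abse.
apply: lime_le; first by apply/cvg_ex; eexists; exact: L'.
apply: nearW => k.
rewrite integral_sum_dcut_field//.
have k1 : 1 <= k.+1%:R :> R by rewrite ler1n.
apply: (le_trans (lee_abs_sum _ _ _)).
apply: (@le_trans _ _ (\sum_(i < n) ((expR 1 * M)%:E * vector_measure_variation nu))%E).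
  apply: lee_sum => i _.
  have tF : test_function (cut_field eps g k.+1%:R i) by exact: test_cut_field.
  rewrite -uv; last first.
    by apply: continuous_measurable_rV; apply: smooth_continuous_partial; case: tF.
  rewrite Du// abseN; apply: charge_integral_le.
    by apply: continuous_measurable_rV; apply: smooth_continuous; case: tF.
  by move=> x; exact: cut_field_le.
have -> : (n%:R * (expR 1 * M))%:E = (\sum_(i < n) (expR 1 * M)%:E)%E.
  by rewrite sumEFin sumr_const card_ord mulr_natl.
rewrite ge0_sume_distrl// => i _; rewrite lee_fin mulr_ge0 ?expR_ge0//.
exact: le_trans (gM 0).
Qed.

End radial_dual.

(** * The distributional gradient of a test function *)

Section density_charge.
Context {R : realType} {n : nat}.
Local Notation mu := (@lebesgue_rV R n).

(** The density k may be negative on a null set, so it is compared with the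
    Radon-Nikodym derivative of m. *)
Lemma integral_density (m : {finite_measure set 'rV[R]_n -> \bar R})
    (k phi : 'rV[R]_n -> R) (C : R) :
  mu.-integrable setT (EFin \o k) ->
  (forall A, measurable A -> m A = \int[mu]_(x in A) (k x)%:E)%E ->
  measurable_fun setT phi -> (forall x, `|phi x| <= C) ->
  (\int[m]_x (phi x)%:E = \int[mu]_x (phi x * k x)%:E)%E.
Proof.
move=> ik mk mphi phiC.
have mmu : m `<< mu.
  apply/null_content_dominatesP => A mA muA; rewrite mk//.
  by apply: null_set_integral => //; apply: measurable_funTS; exact: measurable_int ik.
have iphi : m.-integrable setT (EFin \o phi).
  apply: measurable_bounded_integrable => //.
    by rewrite -ge0_fin_numE// fin_num_measure.
  exists C; split; first exact: num_real.
  by move=> r Cr x _ /=; rewrite (le_trans (phiC x))// ltW.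
rewrite -(Radon_Nikodym_change_of_variables mmu measurableT iphi).
have mmu' : charge_of_finite_measure m `<< mu by exact: mmu.
have mRN := measurable_int _ (Radon_Nikodym_integrable mmu').
apply: ae_eq_integral => //.
- apply: emeasurable_funM => //; exact/measurable_EFinP.
- apply/measurable_EFinP; apply: measurable_funM => //.
  by apply/measurable_EFinP; exact: measurable_int ik.
have : ae_eq mu setT (EFin \o k) (Radon_Nikodym (charge_of_finite_measure m) mu).
  apply: integral_ae_eq => // A _ mA.
  by rewrite -Radon_Nikodym_integral// -mk.
by apply: filterS => x kx _; rewrite -kx.
Qed.

Variable h : 'rV[R]_n -> R.
Hypothesis ih : mu.-integrable setT (EFin \o h).
Local Notation nu := (induced_charge ih).

Lemma charge_integral_induced (phi : 'rV[R]_n -> R) (C : R) :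
  measurable_fun setT phi -> (forall x, `|phi x| <= C) ->
  (charge_integral nu (EFin \o phi) = \int[mu]_x (phi x * h x)%:E)%E.
Proof.
move=> mphi phiC; rewrite /charge_integral.
set P := projT1 (cid (Hahn_decomposition nu)).
set N := projT1 (cid (projT2 (cid (Hahn_decomposition nu)))).
set nuPN := projT2 _.
have [[mP _] [mN _] PN PN0] := nuPN.
have ir (A : set 'rV[R]_n) : measurable A ->
    mu.-integrable setT (EFin \o (fun x => h x * \1_A x)).
  move=> mA; apply: (integrable_mul_bounded (D := 1) ih).
    exact: measurable_indic.
  by move=> x; rewrite indicE ger0_norm// lern1 leq_b1.
have irN : mu.-integrable setT (EFin \o (fun x => - (h x * \1_N x))).
  by have := integrableN (ir _ mN).
have rest (A B : set 'rV[R]_n) : measurable A -> measurable B ->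
    (\int[mu]_(x in A `&` B) (h x)%:E = \int[mu]_(x in A) (h x * \1_B x)%:E)%E.
  move=> mA mB; rewrite integral_mkcondr; apply: eq_integral => x _.
  by rewrite patchE indicE; case: (x \in B); rewrite ?mulr1 ?mulr0.
rewrite (@integral_density (jordan_pos nuPN) (fun x => h x * \1_P x) phi C)//; last 2 first.
- exact: ir.
- move=> A mA; rewrite -[LHS]/(jordan_pos nuPN A).
  rewrite jordan_posE charge.cjordan_posE /crestr0 mem_set//= /crestr.
  exact: rest.
rewrite (@integral_density (jordan_neg nuPN) (fun x => - (h x * \1_N x)) phi C)//; last first.
  move=> A mA; rewrite -[LHS]/(jordan_neg nuPN A).
  rewrite jordan_negE charge.cjordan_negE /crestr0 mem_set//= /crestr.
  rewrite [X in (- X)%E](rest A N)// -integralN//.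
  apply: integrable_add_def => //.
  by apply: (integrableS measurableT) => //; exact: ir.
have mb (w : 'rV[R]_n -> R) : mu.-integrable setT (EFin \o w) ->
    mu.-integrable setT (EFin \o (fun x => phi x * w x)).
  move=> iw; have := integrable_mul_bounded iw mphi phiC.
  by apply: eq_integrable => // x _ /=; rewrite mulrC.
rewrite -integralB_EFin//; [|exact: mb (ir _ mP)|exact: mb irN].
apply: eq_integral => x _ /=; rewrite -EFinB mulrN opprK -mulrDr -mulrDr.
have : (P `|` N) x by rewrite PN.
have nPN : ~ (P x /\ N x) by move=> PNx; have : (P `&` N) x by []; rewrite PN0.
rewrite !indicE => -[Px|Nx].
  by rewrite mem_set// memNset ?addr0 ?mulr1// => Nx; apply: nPN.
by rewrite [x \in N]mem_set// memNset ?add0r ?mulr1// => Px; apply: nPN.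
Qed.

End density_charge.

Section gradient_charge.
Context {R : realType} {n : nat}.
Local Notation mu := (@lebesgue_rV R n).

Lemma variation_induced (h : 'I_n -> 'rV[R]_n -> R)
    (ih : forall i, mu.-integrable setT (EFin \o h i)) :
  (vector_measure_variation (fun i => induced_charge (ih i)) <=
   \int[mu]_x (\sum_(i < n) `|h i x|)%:E)%E.
Proof.
have mh i : measurable_fun setT (h i).
  by apply/measurable_EFinP; exact: measurable_int (ih i).
have ms : measurable_fun setT (fun x => (\sum_(i < n) `|h i x|)%:E).
  apply/measurable_EFinP; apply: measurable_sum => i.
  exact: measurableT_comp.
apply: ge_ereal_sup => _ [E [mE tE UE] <-].
rewrite -UE ge0_integral_bigcup//; last 2 first.
- exact: measurable_funTS.
- by move=> x _; rewrite lee_fin sumr_ge0.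
apply: lee_nneseries => k _; first by move=> _; rewrite lee_fin enorm_ge0.
apply: (@le_trans _ _ (\sum_(i < n) `|induced_charge (ih i) (E k)|)%E).
  apply: (@le_trans _ _ (\sum_(i < n) `|fine (induced_charge (ih i) (E k))|)%:E).
    rewrite lee_fin (le_trans (enorm_le_sum _))//.
    by apply: ler_sum => i _; rewrite mxE.
  rewrite -sumEFin; apply: lee_sum => i _.
  by rewrite -[X in (_ <= `|X|)%E]fineK// fin_num_measure.
under [leRHS]eq_integral do rewrite -sumEFin.
rewrite ge0_integral_sum//; last first.
  by move=> i; apply/measurable_EFinP; apply: measurable_funTS; exact: measurableT_comp.
apply: lee_sum => i _.
apply: le_abse_integral => //.
by apply/measurable_EFinP; exact: measurable_funTS.
Qed.

(** Integrating by parts, the gradient is the measure whose density is the classical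
    one. *)
Lemma test_function_gradient (u : 'rV[R]_n -> R) : test_function u ->
  exists nu : 'I_n -> {charge set 'rV[R]_n -> \bar R},
    [/\ in_BVc u, distributional_gradient u nu &
     (vector_measure_variation nu <= \int[mu]_x (\sum_(i < n) `|partial i u x|)%:E)%E].
Proof.
move=> [su cu]; have [r r0 ur] := compact_support_vanishes cu.
have ctu := smooth_continuous su.
have du i : forall x, is_derive x (delta_mx ord0 i) u (partial i u x : R^o).
  exact: smooth_is_derive.
have cpu i : continuous (partial i u) by exact: smooth_continuous_partial.
have ih i : mu.-integrable setT (EFin \o partial i u).
  exact: integrable_continuous_support (cpu i) (partial_vanishes_outside ur (du i)).
exists (fun i => induced_charge (ih i)).
have Du : distributional_gradient u (fun i => induced_charge (ih i)).
  move=> i phi [sphi cphi]; have [r' _ phir] := compact_support_vanishes cphi.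
  have ctphi := smooth_continuous sphi.
  have [C _ hC] := vanishes_outside_bounded phir ctphi.
  rewrite (charge_integral_induced _ (continuous_measurable_rV ctphi) hC).
  have dphi x : is_derive x (delta_mx ord0 i) phi (partial i phi x : R^o).
    exact: smooth_is_derive.
  rewrite (integral_by_parts (du i) dphi _ _ _ _ ur)//.
    by congr (- _)%E; apply: eq_integral => x _; rewrite mulrC.
  exact: smooth_continuous_partial.
split=> //; last exact: variation_induced.
have [C _ hC] := vanishes_outside_bounded ur ctu.
split.
- split; last by eexists; exact: Du.
  exact: integrable_continuous_support ctu ur.
- by exists C; apply: aeW => x; exact: hC.
- exists [set x | enorm x <= r]; first exact: compact_cball.
  by apply: aeW => x /negP; rewrite -ltNge => /ltW/ur.
Qed.

End gradient_charge.

(** * Bumps on small balls *)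

Section bump.
Context {R : realType} {n : nat}.
Local Notation mu := (@lebesgue_rV R n).
Implicit Types (x : 'rV[R]_n) (r : R).

Definition bump r x : R := flat 0 (1 - (r ^+ 2)^-1 * enorm x ^+ 2).

Lemma bump_vanishes r : 0 < r -> vanishes_outside r (bump r).
Proof.
move=> r0 x rx; rewrite /bump flat_le0// subr_le0 -ler_pdivrMl ?invr_gt0 ?exprn_gt0//.
by rewrite invrK mulr1 lerXn2r ?nnegrE ?enorm_ge0// ltW.
Qed.

Lemma bump_ge0 r x : 0 <= bump r x.
Proof. exact: flat_ge0. Qed.

Lemma bump_le1 r x : bump r x <= 1.
Proof. exact: flat0_le1. Qed.

Lemma bump_norm_le1 r x : `|bump r x| <= 1.
Proof. by rewrite ger0_norm ?bump_ge0 ?bump_le1. Qed.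

Lemma smooth_bump r : smooth (bump r).
Proof.
apply: Ck_smooth => m.
apply: (Ck_comp (h := fun s => flat 0 (1 - (r ^+ 2)^-1 * s))); last exact: Ck_sqr_enorm.
apply: (ndiff_on_comp (V := setT) (g := fun s => 1 - (r ^+ 2)^-1 * s)) => //.
  exact: ndiff_on_flat.
have := ndiff_on_affine [set: R] m.+1 (- (r ^+ 2)^-1) 1.
by congr ndiff_on; apply/funext => s; rewrite mulNr addrC.
Qed.

Lemma test_bump r : 0 < r -> test_function (bump r).
Proof.
move=> r0; split; first exact: smooth_bump.
exact: (vanishes_compact_support (bump_vanishes r0)).
Qed.

Lemma measurable_bump r : measurable_fun setT (bump r).
Proof.
by apply: continuous_measurable_rV; exact: (smooth_continuous (smooth_bump r)).
Qed.

Lemma bump_ge r x : 0 < r -> enorm x <= r / 2 -> expR (- 2) <= bump r x.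
Proof.
move=> r0 xr; have h : 2^-1 <= 1 - (r ^+ 2)^-1 * enorm x ^+ 2.
  rewrite lerBrDr -lerBrDl ler_pdivrMl ?exprn_gt0//.
  apply: (@le_trans _ _ ((r / 2) ^+ 2)).
    by rewrite lerXn2r ?nnegrE ?enorm_ge0// divr_ge0// ltW.
  rewrite exprMn ler_wpM2l ?sqr_ge0// expr2; lra.
have h0 : 0 < 1 - (r ^+ 2)^-1 * enorm x ^+ 2 by apply: lt_le_trans h; lra.
rewrite /bump /flat h0 expr0 mul1r ler_expR lerN2.
by rewrite -[leRHS]invrK lef_pV2 ?posrE ?invr_gt0.
Qed.

Lemma partial_bump r (i : 'I_n) x : partial i (bump r) x =
  flat 2 (1 - (r ^+ 2)^-1 * enorm x ^+ 2) * (- (r ^+ 2)^-1 * (2 * x ord0 i)).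
Proof.
have da (s : R) : is_derive s (1 : R) (fun s : R => 1 - (r ^+ 2)^-1 * s)
    (- (r ^+ 2)^-1 : R^o).
  apply: is_derive_eq.
  by rewrite add0r mul1r [(r ^+ 2)^-1 *: _]mulr1.
have db := is_derive1_comp (g := fun s : R => 1 - (r ^+ 2)^-1 * s)
  (is_derive_flat 0 (1 - (r ^+ 2)^-1 * enorm x ^+ 2)) (da _).
have [_] := is_derive_comp_line db (is_derive_sqr_enorm i x).
by move=> dE; rewrite [LHS]dE mul0r subr0 -mulrA.
Qed.

Lemma partial_bump_vanishes r (i : 'I_n) : 0 < r ->
  vanishes_outside r (partial i (bump r)).
Proof.
move=> r0 x rx; rewrite partial_bump flat_le0 ?mul0r//.
rewrite subr_le0 -ler_pdivrMl ?invr_gt0 ?exprn_gt0//.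
by rewrite invrK mulr1 lerXn2r ?nnegrE ?enorm_ge0// ltW.
Qed.

Lemma partial_bump_le : exists2 K : R, 0 <= K & forall r (i : 'I_n) x, 0 < r ->
  `|partial i (bump r) x| <= K / r.
Proof.
have [K K0 hK] := @flat_le R 2; exists (2 * K); first by rewrite mulr_ge0 ?ltW.
move=> r i x r0; have [rx|xr] := leP r (enorm x).
  by rewrite partial_bump_vanishes// normr0 divr_ge0 ?mulr_ge0// ltW.
rewrite partial_bump normrM (ger0_norm (flat_ge0 _ _)).
have -> : 2 * K / r = K * (2 / r) by ring.
rewrite ler_pM ?flat_ge0//.
rewrite normrM normrN normfV (ger0_norm (sqr_ge0 _)) ler_pdivrMl ?exprn_gt0//.
have -> : r ^+ 2 * (2 / r) = 2 * r by field; rewrite gt_eqF.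
rewrite normrM ger0_norm// ler_wpM2l//.
by rewrite (le_trans (coord_le_enorm _ _))// ltW.
Qed.

Lemma powR_predn r : 0 < r -> r ^+ n / r = r `^ (n%:R - 1).
Proof.
move=> r0; rewrite -powR_mulrn ?ltW// !powR_expR// mulrBl mul1r expRB lnK//.
Qed.

Lemma integral_partial_bump : exists2 K : R, 0 <= K & forall r, 0 < r ->
  (\int[mu]_x (\sum_(i < n) `|partial i (bump r) x|)%:E <=
   (K * r `^ (n%:R - 1))%:E)%E.
Proof.
have [K K0 hK] := partial_bump_le; exists (n%:R * K * 2 ^+ n).
  by rewrite !mulr_ge0// exprn_ge0.
move=> r r0; have rK : 0 <= n%:R * (K / r) by rewrite mulr_ge0// divr_ge0// ltW.
apply: (@le_trans _ _ (\int[mu]_(x in eball r) (n%:R * (K / r))%:E)%E).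
  rewrite [leRHS]integral_mkcond; apply: ge0_le_integral => //.
  - by move=> x _; rewrite lee_fin sumr_ge0.
  - apply/measurable_EFinP; apply: measurable_sum => i.
    apply: measurableT_comp => //; apply: continuous_measurable_rV.
    exact/smooth_continuous_partial/smooth_bump.
  - apply/(measurable_restrictT _ (measurable_eball _)).
    exact: measurable_cst.
  move=> x _; rewrite patchE; case: ifPn => [_|].
    rewrite lee_fin -[X in X%:R * _]card_ord mulr_natl -sumr_const.
    by apply: ler_sum => i _; exact: hK.
  rewrite notin_setE /eball/= => /negP; rewrite -leNgt => rx.
  by rewrite big1// => i _; rewrite partial_bump_vanishes// normr0.
rewrite integral_cst; last exact: measurable_eball.
rewrite (le_trans (lee_wpmul2l _ (eball_measure_le r0)))// -EFinM lee_fin.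
rewrite -powR_predn// exprMn le_eqVlt; apply/orP; left; apply/eqP.
by field; rewrite gt_eqF.
Qed.

Lemma integrable_powR_bump (a r : R) (q : 'rV[R]_n -> R) : 0 < a -> a < n%:R -> 0 < r ->
  measurable_fun setT q -> (forall x, `|q x| <= 1) ->
  mu.-integrable setT (EFin \o (fun x => q x * enorm x `^ (- a) * bump r x)).
Proof.
move=> a0 an r0 mq q1.
have := @integrable_powR_support _ n a (fun x => q x * bump r x) 1 r a0 an.
move=> /(_ _ _ _)/wrap[].
- by apply: measurable_funM => //; exact: measurable_bump.
- by move=> x; rewrite normrM -[leRHS]mulr1 ler_pM//; exact: bump_norm_le1.
- by move=> x rx; rewrite bump_vanishes// mulr0.
by apply: eq_integrable => // x _ /=; rewrite mulrAC.
Qed.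

Lemma integrable_inv_bump r (q : 'rV[R]_n -> R) : 1 < n%:R :> R -> 0 < r ->
  measurable_fun setT q -> (forall x, `|q x| <= 1) ->
  mu.-integrable setT (EFin \o (fun x => q x * (enorm x)^-1 * bump r x)).
Proof.
move=> n1 r0 mq q1; have := integrable_powR_bump ltr01 n1 r0 mq q1.
by apply: eq_integrable => // x _ /=; rewrite powR_inv1 ?enorm_ge0.
Qed.

Lemma integrable_powR_eps_bump (eps r : R) : 0 < eps -> eps < n%:R - 1 -> 0 < r ->
  mu.-integrable setT (EFin \o (fun x => enorm x `^ (- 1 - eps) * bump r x)).
Proof.
move=> e0 en r0.
have := @integrable_powR_bump (1 + eps) r (cst 1) _ _ r0 _ _.
move=> /(_ _ _ _ _)/wrap[].
- by rewrite ltr_wpDl.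
- by rewrite -ltrBrDl.
- exact: measurable_cst.
- by move=> x; rewrite normr1.
by apply: eq_integrable => // x _ /=; rewrite mul1r opprD.
Qed.

Lemma integral_inv_bump : 1 < n%:R :> R ->
  exists2 K : R, 0 <= K & forall r (q : 'rV[R]_n -> R), 0 < r ->
  measurable_fun setT q -> (forall x, `|q x| <= 1) ->
  `|\int[mu]_x (q x * (enorm x)^-1 * bump r x)| <= K * r `^ (n%:R - 1).
Proof.
move=> n1; have [K K0 hK] := integral_powR_eball (n := n) ltr01 n1.
exists K => // r q r0 mq q1.
have E x : (enorm x)^-1 = enorm x `^ (- 1) by rewrite powR_inv1// enorm_ge0.
have i1 := integrable_inv_bump n1 r0 mq q1.
rewrite -lee_fin EFin_normr_Rintegral// (le_trans _ (hK _ r0))//.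
apply: (le_trans (le_abse_integral _ _ _)) => //; first exact: measurable_int i1.
rewrite [leRHS]integral_mkcond; apply: ge0_le_integral => //.
- by apply: measurableT_comp => //; exact: measurable_int i1.
- apply/(measurable_restrictT _ (measurable_eball _)).
  by apply: measurable_funTS; apply/measurable_EFinP; exact: measurable_enorm_powR.
move=> x _; rewrite patchE; case: ifPn => [_|].
  rewrite abse_EFin lee_fin -E normrM -[leRHS]mulr1 ler_pM ?bump_norm_le1//.
  rewrite normrM -[leRHS]mul1r ler_pM// ger0_norm// invr_ge0.
  exact: enorm_ge0.
rewrite notin_setE /eball/= => /negP; rewrite -leNgt => rx.
by rewrite bump_vanishes// mulr0 normr0.
Qed.

(** The mass is bounded below on the open box with edges ]0, r / (2n)[: it is
    contained in the ball of radius r / 2, where the bump is at least exp(-2), and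
    it avoids the origin, where the power is 0 by convention. *)
Lemma integral_powR_bump (eps : R) : 0 < eps -> eps < n%:R - 1 ->
  exists2 c : R, 0 < c & forall r, 0 < r ->
  c * r `^ (n%:R - 1 - eps) <= \int[mu]_x (enorm x `^ (- 1 - eps) * bump r x).
Proof.
move=> e0 en.
have n0' := dim_gt0 e0 en; have n0 : 0 < n%:R :> R by rewrite ltr0n.
pose c : R := expR (- 2) * 2^-1 `^ (- 1 - eps) * (2 * n%:R)^-1 ^+ n.
exists c.
  by rewrite /c !mulr_gt0 ?expR_gt0 ?powR_gt0 ?exprn_gt0 ?invr_gt0 ?mulr_gt0.
move=> r r0.
have i1 := integrable_powR_eps_bump e0 en r0.
pose b : R := r / (2 * n%:R).
have b0 : 0 < b by rewrite divr_gt0// mulr_gt0.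
pose Q : set 'rV[R]_n := [set x | forall i, `]0, b[%classic (x ord0 i)].
have mQ : measurable Q by exact: (measurable_box (A := fun=> `]0, b[%classic)).
have muQ : mu Q = (b ^+ n)%:E.
  rewrite /Q (lebesgue_rV_box (A := fun=> `]0, b[%classic))//.
  under eq_bigr do rewrite lebesgue_measure_itv/= lte_fin b0 oppr0 adde0.
  by rewrite prodEFin prodr_const card_ord.
have Qx x : Q x -> 0 < enorm x /\ enorm x <= r / 2.
  move=> xQ; split.
    have := xQ (Ordinal n0'); rewrite /= in_itv/= => /andP[x0 _].
    by rewrite (lt_le_trans x0)// (le_trans (ler_norm _))// coord_le_enorm.
  rewrite (le_trans (enorm_le_sum x))//.
  have -> : r / 2 = \sum_(i < n) b.
    by rewrite sumr_const card_ord -[RHS]mulr_natr /b; field; rewrite gt_eqF.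
  apply: ler_sum => i _; have := xQ i; rewrite /= in_itv/= => /andP[xi0 xib].
  by rewrite gtr0_norm// ltW.
rewrite -lee_fin.
rewrite [leRHS](_ : _ = \int[mu]_x (enorm x `^ (- 1 - eps) * bump r x)%:E)%E; last first.
  by rewrite /Rintegral fineK//; exact: (integrable_fin_num _ i1).
apply: (@le_trans _ _ (\int[mu]_(x in Q) (expR (- 2) * (r / 2) `^ (- 1 - eps))%:E)%E).
  rewrite integral_cst// [X in (_ * X)%E]muQ -EFinM lee_fin.
  rewrite le_eqVlt; apply/orP; left; apply/eqP.
  have -> : b = r * (2 * n%:R)^-1 by [].
  rewrite powRM ?ltW// exprMn /c.
  have -> : r `^ (n%:R - 1 - eps) = r `^ (- 1 - eps) * r ^+ n.
    rewrite -powR_mulrn ?ltW// !powR_expR// -expRD; congr expR; ring.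
  by ring.
rewrite [leLHS]integral_mkcond; apply: ge0_le_integral => //.
- move=> x _; rewrite patchE; case: ifPn => // _.
  by rewrite lee_fin mulr_ge0 ?expR_ge0 ?powR_ge0.
- apply/(measurable_restrictT _ mQ); exact: measurable_cst.
- exact: measurable_int i1.
move=> x _; rewrite patchE; case: ifPn => [|_]; last first.
  by rewrite lee_fin mulr_ge0 ?powR_ge0 ?bump_ge0.
rewrite inE => /Qx[x0 xr]; rewrite lee_fin mulrC ler_pM ?powR_ge0 ?expR_ge0//.
  rewrite -opprD !powRN lef_pV2 ?posrE ?powR_gt0// ?divr_gt0//.
  by rewrite ge0_ler_powR ?nnegrE ?addr_ge0// ?ltW// divr_gt0.
exact: bump_ge.
Qed.

End bump.

(** * The oscillating density *)

Section radial_bump.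
Context {R : realType} {n : nat}.
Variables (eps : R) (g g' : R -> R) (M : R).
Hypothesis eps_gt0 : 0 < eps.
Hypothesis eps_ltn : eps < n%:R - 1.
Hypothesis Dg : forall m, ndiff_on setT m g.
Hypothesis dg : forall s, is_derive s (1 : R) g (g' s : R^o).
Hypothesis mg' : measurable_fun setT g'.
Hypothesis gM : forall s, `|g s| <= M.
Hypothesis g'M : forall s, `|g' s| <= M.
Local Notation mu := (@lebesgue_rV R n).
Local Notation divF := (@radial_div R n eps g g').

Lemma integrable_radial_div_mul (u : 'rV[R]_n -> R) (C r : R) :
  measurable_fun setT u -> (forall x, `|u x| <= C) -> vanishes_outside r u ->
  mu.-integrable setT (EFin \o (fun x => divF x * u x)).
Proof.
move=> mU uC ur.
have mdiv : measurable_fun setT divF by exact: measurable_radial_div.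
have iw := integrable_weight_support eps_gt0 eps_ltn mU uC ur.
apply: (le_integrable measurableT _ _ (integrableZl measurableT ((eps + n%:R) * M) iw)).
  by apply/measurable_EFinP; exact: measurable_funM.
move=> x _; rewrite /= !lee_fin !normrM mulrC mulrCA ler_wpM2l//.
have := radial_div_le_weight eps_gt0 eps_ltn gM g'M x => h.
by rewrite (le_trans h)// (le_trans (ler_norm _))// !normrM.
Qed.

(** The gain over the integral of the absolute value, which is of order
    r^(n-1-eps), comes from [radial_divergence]: the field is bounded and the
    gradient of the bump has integral O(r^(n-1)). *)
Lemma radial_div_bump : exists2 K : R, 0 <= K & forall r, 0 < r ->
  `|\int[mu]_x (divF x * bump r x)| <= K * r `^ (n%:R - 1).
Proof.
have [K K0 hK] := @integral_partial_bump R n.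
have M0 : 0 <= M by exact: le_trans (gM 0).
exists (M * K); first exact: mulr_ge0.
move=> r r0.
have tb := @test_bump R n r r0.
have cpb i : continuous (partial i (@bump R n r)).
  by apply: smooth_continuous_partial; exact: smooth_bump.
have i1 := integrable_radial_div_mul (measurable_bump r) (bump_norm_le1 r)
  (bump_vanishes r0).
rewrite -lee_fin EFin_normr_Rintegral//.
rewrite (radial_divergence eps_gt0 eps_ltn Dg dg gM g'M tb) abseN.
have mF i : measurable_fun setT (fun x : 'rV[R]_n =>
    (enorm x)^-1 * g (enorm x `^ (- eps)) * x ord0 i).
  exact: measurable_radial_field.
have mpb i : measurable_fun setT (partial i (@bump R n r)).
  exact: continuous_measurable_rV.
have ms : measurable_fun setT (fun x : 'rV[R]_n => \sum_(i < n)
    (enorm x)^-1 * g (enorm x `^ (- eps)) * x ord0 i * partial i (bump r) x).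
  by apply: measurable_sum => i; exact: measurable_funM.
apply: (le_trans (le_abse_integral _ _ _)) => //; first exact/measurable_EFinP.
apply: (@le_trans _ _ (\int[mu]_x (M%:E * (\sum_(i < n) `|partial i (bump r) x|)%:E))%E).
  apply: ge0_le_integral => //.
  - by apply: measurableT_comp => //; exact/measurable_EFinP.
  - apply: measurable_funeM; apply/measurable_EFinP; apply: measurable_sum => i.
    exact: measurableT_comp.
  move=> x _; rewrite -EFinM abse_EFin lee_fin mulr_sumr.
  rewrite (le_trans (ler_norm_sum _ _ _))//; apply: ler_sum => i _.
  by rewrite normrM ler_wpM2r//; exact: radial_field_le.
rewrite ge0_integralZl ?lee_fin//.
- rewrite -mulrA EFinM lee_wpmul2l ?lee_fin//; exact: hK.
- apply/measurable_EFinP; apply: measurable_sum => i.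
  exact: measurableT_comp.
- by move=> x _; rewrite lee_fin sumr_ge0.
Qed.

End radial_bump.

Section oscillating.
Context {R : realType} {n : nat}.
Variable eps : R.
Hypothesis eps_gt0 : 0 < eps.
Hypothesis eps_ltn : eps < n%:R - 1.
Local Notation mu := (@lebesgue_rV R n).
Implicit Types (s : R) (x : 'rV[R]_n).

Lemma ndiff_on_cos m : ndiff_on setT m (@cos R).
Proof. by have [] := @ndiff_on_cos_sin R setT m. Qed.

Lemma ndiff_on_sin m : ndiff_on setT m (@sin R).
Proof. by have [] := @ndiff_on_cos_sin R setT m. Qed.

Lemma sin_norm_le1 s : `|sin s| <= 1.
Proof. by rewrite ler_norml sin_geN1 sin_le1. Qed.

Lemma cos_norm_le1 s : `|cos s| <= 1.
Proof. by rewrite ler_norml cos_geN1 cos_le1. Qed.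

Lemma measurable_sin : measurable_fun setT (@sin R).
Proof. by apply: continuous_measurable_fun; exact: continuous_sin. Qed.

Lemma measurable_cos : measurable_fun setT (@cos R).
Proof. by apply: continuous_measurable_fun; exact: continuous_cos. Qed.

(** A primitive of sin + sin^2 - 1/2: the choice of g that lets a divergence absorb
    the oscillating part of sin + sin^2. *)
Definition balance s : R := - 1 * cos s + - 2^-1 * (sin s * cos s).
Definition dbalance s : R := sin s - 2^-1 * (cos s ^+ 2 - sin s ^+ 2).

Lemma ndiff_on_balance m : ndiff_on setT m balance.
Proof.
apply: ndiff_onD; apply: ndiff_onM;
  [exact: ndiff_on_cst|exact: ndiff_on_cos|exact: ndiff_on_cst|].
by apply: ndiff_onM; [exact: ndiff_on_sin|exact: ndiff_on_cos].
Qed.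

Lemma is_derive_balance s : is_derive s (1 : R) balance (dbalance s : R^o).
Proof.
have dsc := is_deriveM (is_derive_sin s) (is_derive_cos s).
apply: (is_derive_eq (is_deriveD
  (is_deriveM (is_derive_cst (- 1 : R^o) s (1 : R)) (is_derive_cos s))
  (is_deriveM (is_derive_cst (- 2^-1 : R^o) s (1 : R)) dsc))).
by rewrite /dbalance /GRing.scale/=; ring.
Qed.

Lemma balance_le s : `|balance s| <= 3.
Proof.
have c1 := cos_norm_le1 s; have sc : `|sin s * cos s| <= 1.
  by rewrite normrM -[leRHS]mulr1 ler_pM// sin_norm_le1.
move: c1 sc; rewrite /balance !ler_norml => /andP[? ?] /andP[? ?].
by apply/andP; split; lra.
Qed.

Lemma dbalance_le s : `|dbalance s| <= 3.
Proof.
have s1 := sin_norm_le1 s; have := cos2Dsin2 s.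
have := sqr_ge0 (sin s); have := sqr_ge0 (cos s).
move: s1; rewrite /dbalance !ler_norml => /andP[? ?] *.
by apply/andP; split; lra.
Qed.

Lemma measurable_dbalance : measurable_fun setT dbalance.
Proof.
apply: measurable_funB; first exact: measurable_sin.
apply: measurable_funM => //; apply: measurable_funB;
  apply: measurable_funX; [exact: measurable_cos|exact: measurable_sin].
Qed.

(** The function f of the theorem. *)
Definition osc x : R := radial_div eps (@cos R) (fun s => - sin s) x.

(** The weight makes the leading term of f biased towards positive values, since
    sin (1 + sin) has mean 1/2, while it keeps f w below f^+. *)
Definition sin_weight x : R := (1 + sin (enorm x `^ (- eps))) / 2.

Lemma sin_weight01 x : 0 <= sin_weight x <= 1.
Proof.
have := sin_geN1 (enorm x `^ (- eps)); have := sin_le1 (enorm x `^ (- eps)).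
by rewrite /sin_weight => ? ?; apply/andP; split; lra.
Qed.

Lemma measurable_sin_weight : measurable_fun setT sin_weight.
Proof.
apply: measurable_funM => //; apply: measurable_funD => //.
exact: (measurableT_comp measurable_sin (measurable_enorm_powR _)).
Qed.

Lemma osc_sin_weight x (b : R) : osc x * b * sin_weight x =
  eps / 4 * (enorm x `^ (- 1 - eps) * b) +
  ((- 2^-1) * (radial_div eps balance dbalance x * b) +
  (n%:R - 1) / 4 * (sin (enorm x `^ (- eps)) * cos (enorm x `^ (- eps)) *
     (enorm x)^-1 * b)).
Proof.
rewrite /osc /sin_weight /radial_div /balance /dbalance.
have -> : cos (enorm x `^ (- eps)) ^+ 2 = 1 - sin (enorm x `^ (- eps)) ^+ 2.
  by rewrite -(cos2Dsin2 (enorm x `^ (- eps))) addrK.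
by move: (enorm x)^-1 => v; field.
Qed.

Lemma integrable_osc_mul (u : 'rV[R]_n -> R) (C r : R) :
  measurable_fun setT u -> (forall x, `|u x| <= C) -> vanishes_outside r u ->
  mu.-integrable setT (EFin \o (fun x => osc x * u x)).
Proof.
apply: (integrable_radial_div_mul eps_gt0 eps_ltn (@is_derive_cos R) _ cos_norm_le1).
  by apply: measurableT_comp => //; exact: measurable_sin.
by move=> s; rewrite normrN sin_norm_le1.
Qed.

Lemma integrable_osc_bump r : 0 < r ->
  mu.-integrable setT (EFin \o (fun x => osc x * bump r x)).
Proof.
move=> r0; apply: integrable_osc_mul; [exact: measurable_bump|
  exact: bump_norm_le1|exact: bump_vanishes].
Qed.

Lemma integrable_osc_sin_weight_bump r : 0 < r ->
  mu.-integrable setT (EFin \o (fun x => osc x * bump r x * sin_weight x)).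
Proof.
move=> r0; apply: (integrable_mul_bounded (D := 1)); first exact: integrable_osc_bump.
  exact: measurable_sin_weight.
by move=> x; have /andP[? ?] := sin_weight01 x; rewrite ger0_norm.
Qed.

(** The three terms of [osc_sin_weight] are estimated by [integral_powR_bump],
    [radial_div_bump] and [integral_inv_bump]. *)
Lemma osc_lower_bound : exists c C : R, [/\ 0 < c, 0 <= C &
  forall r, 0 < r ->
  c * r `^ (n%:R - 1 - eps) - C * r `^ (n%:R - 1) <=
  \int[mu]_x (osc x * bump r x * sin_weight x)].
Proof.
have n1 : 1 < n%:R :> R by move: (eps_gt0) (eps_ltn) => ? ?; lra.
have [c c0 hc] := @integral_powR_bump R n eps eps_gt0 eps_ltn.
have [K1 K10 hK1] := radial_div_bump eps_gt0 eps_ltn ndiff_on_balance is_derive_balance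
  measurable_dbalance balance_le dbalance_le.
have [K2 K20 hK2] := @integral_inv_bump R n n1.
exists (eps / 4 * c), (2^-1 * K1 + (n%:R - 1) / 4 * K2); split.
- by rewrite mulr_gt0// divr_gt0.
- by rewrite addr_ge0// mulr_ge0// divr_ge0//; lra.
move=> r r0.
pose q x := sin (enorm x `^ (- eps)) * cos (enorm x `^ (- eps)).
have mq : measurable_fun setT q.
  apply: measurable_funM.
    exact: (measurableT_comp measurable_sin (measurable_enorm_powR _)).
  exact: (measurableT_comp measurable_cos (measurable_enorm_powR _)).
have q1 x : `|q x| <= 1.
  by rewrite normrM -[leRHS]mulr1 ler_pM// ?sin_norm_le1 ?cos_norm_le1.
have mb := @measurable_bump R n r; have b1 := @bump_norm_le1 R n r.
have bv := bump_vanishes (n := n) r0.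
have ia := integrable_powR_eps_bump (n := n) eps_gt0 eps_ltn r0.
have ib := integrable_radial_div_mul eps_gt0 eps_ltn is_derive_balance
  measurable_dbalance balance_le dbalance_le mb b1 bv.
have id := integrable_inv_bump n1 r0 mq q1.
have iZ (h : 'rV[R]_n -> R) (k : R) : mu.-integrable setT (EFin \o h) ->
    mu.-integrable setT (EFin \o (fun x => k * h x)).
  by move=> ih; have := integrableZl measurableT k ih.
have -> : \int[mu]_x (osc x * bump r x * sin_weight x) =
  \int[mu]_x (eps / 4 * (enorm x `^ (- 1 - eps) * bump r x) +
  ((- 2^-1) * (radial_div eps balance dbalance x * bump r x) +
  (n%:R - 1) / 4 * (q x * (enorm x)^-1 * bump r x))).
  by apply: eq_Rintegral => x _; exact: osc_sin_weight.
rewrite RintegralD//; [|exact: iZ|]; last first.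
  by have := integrableD measurableT (iZ _ (- 2^-1) ib) (iZ _ ((n%:R - 1) / 4) id).
rewrite RintegralD//; [|exact: iZ|exact: iZ].
rewrite !RintegralZl//.
have := hc r r0; have := hK1 r r0; have := hK2 r q r0 mq q1.
rewrite !ler_norml => /andP[q2 _] /andP[_ d2] a1.
have n4 : 0 <= (n%:R - 1) / 4 :> R by rewrite divr_ge0// subr_ge0 ltW.
have e4 : 0 <= eps / 4 by rewrite divr_ge0// ltW.
have := ler_wpM2l e4 a1; have := ler_wpM2l n4 q2; move: d2.
set A := \int[mu]_x _; set B := \int[mu]_x _; set D := \int[mu]_x _.
lra.
Qed.

(** The first term dominates as soon as r^eps <= c / (2 (C + 1)). *)
Lemma small_radius (c C p : R) : 0 < c -> 0 <= C -> exists2 r0 : R, 0 < r0 &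
  forall r, 0 < r -> r <= r0 ->
    c / 2 * r `^ (p - eps) <= c * r `^ (p - eps) - C * r `^ p.
Proof.
move=> c0 C0; have C1 : 0 < 2 * (C + 1) by rewrite mulr_gt0// ltr_wpDl.
pose a := c / (2 * (C + 1)); have a0 : 0 < a by rewrite divr_gt0.
exists (a `^ eps^-1); first exact: powR_gt0.
move=> r r0 ra.
have ea : r `^ eps <= a.
  have -> : a = (a `^ eps^-1) `^ eps.
    by rewrite -powRrM mulVf ?gt_eqF// powRr1// ltW.
  by rewrite ge0_ler_powR// ?nnegrE ?powR_ge0// ltW.
have -> : r `^ p = r `^ eps * r `^ (p - eps).
  by rewrite !powR_expR// -expRD; congr expR; ring.
rewrite mulrA -mulrBl ler_wpM2r ?powR_ge0//.
have : C * r `^ eps <= c / 2; last by lra.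
apply: (@le_trans _ _ ((C + 1) * a)).
  by rewrite ler_pM ?powR_ge0// lerDl.
rewrite /a le_eqVlt; apply/orP; left; apply/eqP; field.
by rewrite gt_eqF// ltr_wpDl.
Qed.

Lemma positive_part_lower_bound (c r : R) : 0 < r ->
  c <= \int[mu]_x (osc x * bump r x * sin_weight x) ->
  (c%:E <= \int[mu]_(x in eball r) (osc^\+ x)%:E)%E.
Proof.
move=> r0 cr; have ih := integrable_osc_sin_weight_bump r0.
have mosc : measurable_fun setT osc.
  apply: (measurable_radial_div _ (@is_derive_cos R)).
  by apply: measurableT_comp => //; exact: measurable_sin.
apply: (@le_trans _ _ (\int[mu]_x (osc x * bump r x * sin_weight x)%:E)%E).
  rewrite -[leRHS]fineK ?lee_fin//; exact: (integrable_fin_num _ ih).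
rewrite [leLHS]integralE -[leRHS]sube0; apply: leeB; last exact: integral_ge0.
rewrite [leRHS]integral_mkcond; apply: ge0_le_integral => //.
- by apply: measurable_funepos; exact: measurable_int ih.
- apply/(measurable_restrictT _ (measurable_eball _)).
  apply/measurable_EFinP; apply: measurable_funTS.
  exact: measurable_funrpos.
move=> x _; rewrite patchE; case: ifPn => [_|].
  rewrite funeposE -EFin_max lee_fin -[(osc^\+)%R x]/(Num.max (osc x) 0).
  have /andP[w0 w1] := sin_weight01 x.
  have b0 := @bump_ge0 R n r x; have b1 := @bump_le1 R n r x.
  rewrite ge_max [X in _ && X]le_max lexx orbT andbT.
  have [f0|f0] := leP 0 (osc x).
    by rewrite -mulrA ler_piMr// -[leRHS]mulr1 ler_pM.
  by rewrite -mulrA mulr_le0_ge0 ?mulr_ge0// ltW.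
rewrite notin_setE /eball/= => /negP; rewrite -leNgt => rx.
by rewrite funeposE bump_vanishes// mulr0 mul0r maxxx.
Qed.

(** Testing |f| on a bump would give c r^(n-1-eps) <= C r^(n-1) for all r. *)
Lemma abs_osc_not_dual : ~ in_BV_dual (fun x => `|osc x|).
Proof.
move=> [_ [D hD]].
have n0 := dim_gt0 eps_gt0 eps_ltn.
have [c [C [c0 C0 hc]]] := osc_lower_bound.
have [K K0 hK] := @integral_partial_bump R n.
have D0 : 0 <= C + `|D| * K by rewrite addr_ge0// mulr_ge0.
have [r r0 hr] := small_radius (n%:R - 1) c0 D0.
have [nu [uBV Du nuK]] := test_function_gradient (test_bump (n := n) r0).
have := hD _ _ uBV Du; apply/negP; rewrite -ltNge.
apply: (@le_lt_trans _ _ (`|D| * (K * r `^ (n%:R - 1)))%:E).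
  apply: (@le_trans _ _ (`|D|%:E * vector_measure_variation nu)%E).
    apply: lee_wpmul2r; last by rewrite lee_fin ler_norm.
    apply: le_trans (normr_le_charge_variation nu (Ordinal n0) measurableT
      measurable0 (setU0 _) (setI0 _)).
    by rewrite adde_ge0.
  rewrite EFinM; apply: lee_wpmul2l; first by rewrite lee_fin.
  exact: (le_trans nuK (hK _ r0)).
have ih := integrable_osc_sin_weight_bump r0.
apply: (@lt_le_trans _ _ (\int[mu]_x (osc x * bump r x * sin_weight x)%:E)%E).
  rewrite -[ltRHS]fineK ?lte_fin; last exact: (integrable_fin_num _ ih).
  apply: lt_le_trans (hc _ r0).
  have := hr _ r0 (lexx _).
  have : 0 < c / 2 * r `^ (n%:R - 1 - eps) by rewrite mulr_gt0 ?divr_gt0 ?powR_gt0.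
  by rewrite mulrDl mulrA; lra.
apply: (le_trans _ (lee_abs _)).
apply: le_integral => //.
  have := integrable_abse (integrable_osc_bump r0).
  apply: eq_integrable => // x _ /=.
  by rewrite normrM mulrC (ger0_norm (bump_ge0 _ _)).
move=> x _; rewrite lee_fin.
have /andP[w0 w1] := sin_weight01 x.
have b0 := @bump_ge0 R n r x.
move: (sin_weight x) w0 w1 => w w0 w1.
rewrite (le_trans (ler_norm _))// !normrM (ger0_norm b0) (ger0_norm w0).
by rewrite [leRHS]mulrC ler_piMr// mulr_ge0.
Qed.

End oscillating.

Theorem proposition5p1 (R : realType) (n : nat) (eps : R)
  (eps_gt0 : 0 < eps) (eps_ltn : eps < n%:R - 1) :
  let f := fun x : 'rV[R]_n =>
    eps * enorm x `^ (- 1 - eps) * sin (enorm x `^ (- eps)) +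
    (n%:R - 1) * (enorm x)^-1 * cos (enorm x `^ (- eps)) in
  [/\ distributional_div
        (fun x : 'rV[R]_n => ((enorm x)^-1 * cos (enorm x `^ (- eps))) *: x) f,
      exists c : R, 0 < c /\
        exists r : nat -> R,
          [/\ forall k, 0 < r k,
              decreasing_seq r,
              r @ \oo --> 0 &
              forall k,
                ((c * r k `^ (n%:R - 1 - eps))%:E <=
                 \int[@lebesgue_rV R n]_(x in eball (r k)) (f^\+ x)%:E)%E],
      in_BV_dual f &
      ~ in_BV_dual (fun x => `|f x|)].
Proof.
move=> f; have fE : f = osc eps.
  by apply/funext => x; rewrite /f /osc /radial_div mulrN !mulNr opprK.
have mS : measurable_fun setT (fun s : R => - sin s).
  by apply: measurableT_comp => //; exact: measurable_sin.
have sN1 (s : R) : `|- sin s| <= 1 by rewrite normrN sin_norm_le1.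
rewrite fE; split.
- split.
  + move=> i; under eq_fun do rewrite mxE.
    have mF : measurable_fun setT (fun x : 'rV[R]_n =>
        (enorm x)^-1 * cos (enorm x `^ (- eps)) * x ord0 i).
      by apply: measurable_radial_field; exact: (@is_derive_cos R).
    split=> // K cK; have mK := compact_measurable_rV cK.
    have [r r0 Kr] := compact_eball cK.
    apply: measurable_bounded_integrable => //.
    * apply: le_lt_trans (eball_measure_fin r).
      by apply: le_measure => //; rewrite inE//; exact: measurable_eball.
    * exact: measurable_funTS.
    * exists 1; split => // s s1 x _ /=; rewrite (le_trans _ (ltW s1))//.
      by apply: radial_field_le; exact: cos_norm_le1.
  + exact: (radial_div_locally_integrable eps_gt0 eps_ltn (@is_derive_cos R) mS
      (@cos_norm_le1 R) sN1).
  + move=> phi tphi.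
    rewrite (radial_divergence eps_gt0 eps_ltn (@ndiff_on_cos R) (@is_derive_cos R)
      (@cos_norm_le1 R) sN1 tphi).
    congr (- _)%E; apply: eq_integral => x _; congr EFin.
    by apply: eq_bigr => i _; rewrite mxE.
- have [c [C [c0 C0 hc]]] := osc_lower_bound eps_gt0 eps_ltn.
  have [r0 r00 hr] := small_radius eps_gt0 (n%:R - 1) c0 C0.
  exists (c / 2); split; first exact: divr_gt0.
  have rk k : 0 < r0 / 2 ^+ k by rewrite divr_gt0// exprn_gt0.
  exists (fun k => r0 / 2 ^+ k); split => //.
  + move=> k l /=; rewrite ler_pM2l// lef_pV2 ?posrE ?exprn_gt0//.
    by rewrite ler_eXn2l// ltr1n.
  + have := @cvg_geometric R r0 2^-1; rewrite ger0_norm ?invr_ge0// invf_lt1//.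
    rewrite ltr1n => /(_ isT); apply: cvg_trans; apply: near_eq_cvg.
    by apply: nearW => k; rewrite /geometric/= exprVn.
  + move=> k; apply: positive_part_lower_bound => //.
    apply: le_trans (hc _ (rk k)); apply: hr => //.
    rewrite ler_pdivrMr ?exprn_gt0// ler_peMr//; first exact: ltW.
    by rewrite exprn_ege1 ?ler1n.
- exact: (radial_div_dual eps_gt0 eps_ltn (@ndiff_on_cos R) (@is_derive_cos R) mS
      (@cos_norm_le1 R) sN1).
- exact: abs_osc_not_dual.
Qed.
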